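(* Let $\mathfrak{P}$ be a compactness-like topological property and let $X$ be a locally-$\mathfrak{P}$ space. Let $\zeta X$ be a compactification of $X$, let $\phi:\beta X\to\zeta X$ be the continuous extension of the identity of $X$, and let $E$ be a compact subspace of $\zeta X\setminus X$ containing $\phi[\beta X\setminus\lambda_\mathfrak{P}X]$. Then the subspace $Y=X\cup E$ of $\zeta X$ belongs to $\mathscr{E}_\mathfrak{P}(X)$. Moreover, every element of $\mathscr{E}_\mathfrak{P}(X)$ is (equivalent to an extension) of this form.
   Context: All spaces are completely regular Hausdorff; $\beta X$ is the Stone–Čech compactification. An extension of $X$ is a space containing $X$ as a dense subspace; extensions are identified up to homeomorphisms fixing $X$ pointwise. $\mathscr{E}_\mathfrak{P}(X)$ is the set of all extensions of $X$ with $\mathfrak{P}$ and compact remainder. $X$ is locally-$\mathfrak{P}$ if each point has an open neighborhood whose closure has $\mathfrak{P}$. $\lambda_\mathfrak{P}X=\bigcup\{\mathrm{int}_{\beta X}\mathrm{cl}_{\beta X}C: C\text{ a cozero-set of }X,\ \mathrm{cl}_XC\text{ has }\mathfrak{P}\}$. A topological property is compactness-like if it is hereditary to clopen subspaces, finitely additive, invariant and inverse invariant under perfect surjections, and satisfies Mrówka's condition (W): if a space $Z$ has a point $p$ with an open base $\mathscr{B}$ at $p$ such that $Z\setminus B$ has $\mathfrak{P}$ for all $B\in\mathscr{B}$, then $Z$ has $\mathfrak{P}$. *)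

(* Defs.v *)
From Stdlib Require Import Reals List Classical.
Open Scope R_scope.

Record Top := {
  pt :> Type;
  op : (pt -> Prop) -> Prop;
  op_full : op (fun _ => True);
  op_inter : forall U V, op U -> op V -> op (fun x => U x /\ V x);
  op_union : forall (F : (pt -> Prop) -> Prop),
      (forall U, F U -> op U) -> op (fun x => exists U, F U /\ U x)
}.

Arguments op {t} _.

Section Sub.
Variable (X : Top) (A : X -> Prop).
Definition subT := {x : X | A x}.
Definition sub_op (V : subT -> Prop) : Prop :=
  exists U : X -> Prop, op U /\ forall y, V y <-> U (proj1_sig y).

Lemma sub_full : sub_op (fun _ => True).
Proof. exists (fun _ => True); split; [apply op_full | tauto]. Qed.

Lemma sub_inter : forall U V, sub_op U -> sub_op V -> sub_op (fun x => U x /\ V x).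
Proof.
  intros U V [U' [HU EU]] [V' [HV EV]].
  exists (fun x => U' x /\ V' x); split; [apply op_inter; auto|].
  intro y; rewrite EU, EV; tauto.
Qed.

Lemma sub_union : forall (F : (subT -> Prop) -> Prop),
  (forall U, F U -> sub_op U) -> sub_op (fun x => exists U, F U /\ U x).
Proof.
  intros F HF.
  exists (fun x => exists U, (op U /\ exists V, F V /\ forall y, V y <-> U (proj1_sig y)) /\ U x).
  split.
  - apply op_union; intros U [H _]; exact H.
  - intro y; split.
    + intros [V [FV Vy]]. destruct (HF V FV) as [U [HU EU]].
      exists U; split; [split; [exact HU| exists V; auto] | apply EU; exact Vy].
    + intros [U [[_ [V [FV EV]]] Uy]]. exists V; split; [exact FV | apply EV; exact Uy].
Qed.

Definition sub : Top := {| pt := subT; op := sub_op; op_full := sub_full;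
  op_inter := sub_inter; op_union := sub_union |}.
End Sub.

Definition closed (X : Top) (F : X -> Prop) : Prop := op (fun x => ~ F x).
Definition closure (X : Top) (A : X -> Prop) (x : X) : Prop :=
  forall F, closed X F -> (forall y, A y -> F y) -> F x.
Definition interior (X : Top) (A : X -> Prop) (x : X) : Prop :=
  exists U, op U /\ U x /\ forall y, U y -> A y.
Definition dense (X : Top) (A : X -> Prop) : Prop := forall x, closure X A x.
Definition image {X Y : Type} (f : X -> Y) (y : Y) : Prop := exists x, f x = y.

Definition continuous {X Y : Top} (f : X -> Y) : Prop :=
  forall V : Y -> Prop, op V -> op (fun x => V (f x)).

Definition compact (X : Top) : Prop :=
  forall F : (X -> Prop) -> Prop,
    (forall U, F U -> op U) -> (forall x, exists U, F U /\ U x) ->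
    exists l : list (X -> Prop), (forall U, In U l -> F U) /\
      forall x, exists U, In U l /\ U x.

Definition hausdorff (X : Top) : Prop :=
  forall x y : X, x <> y -> exists U V, op U /\ op V /\ U x /\ V y /\
    forall z, U z -> V z -> False.

Definition rcont {X : Top} (f : X -> R) : Prop :=
  forall x eps, 0 < eps -> exists U, op U /\ U x /\
    forall y, U y -> Rabs (f y - f x) < eps.

Definition completely_regular (X : Top) : Prop :=
  forall (F : X -> Prop) (x : X), closed X F -> ~ F x ->
    exists f : X -> R, rcont f /\ f x = 0 /\ forall y, F y -> f y = 1.

Definition tychonoff (X : Top) : Prop := completely_regular X /\ hausdorff X.

Definition embedding {X Y : Top} (f : X -> Y) : Prop :=
  (forall x x', f x = f x' -> x = x') /\ continuous f /\
  forall U : X -> Prop, op U -> exists V : Y -> Prop, op V /\ forall x, U x <-> V (f x).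

Definition homeomorphism {X Y : Top} (f : X -> Y) : Prop :=
  exists g : Y -> X, continuous f /\ continuous g /\
    (forall x, g (f x) = x) /\ (forall y, f (g y) = y).

Definition closed_map {X Y : Top} (f : X -> Y) : Prop :=
  forall F : X -> Prop, closed X F -> closed Y (fun y => exists x, F x /\ f x = y).

Definition perfect_surj {X Y : Top} (f : X -> Y) : Prop :=
  continuous f /\ closed_map f /\ (forall y, exists x, f x = y) /\
  forall y, compact (sub X (fun x => f x = y)).

Definition open_base_at (Z : Top) (p : Z) (Bs : (Z -> Prop) -> Prop) : Prop :=
  (forall B, Bs B -> op B /\ B p) /\
  forall U, op U -> U p -> exists B, Bs B /\ forall z, B z -> U z.

Definition compactness_like (P : Top -> Prop) : Prop :=
  (forall X : Top, tychonoff X -> P X ->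
     forall A : X -> Prop, op A -> closed X A -> P (sub X A)) /\
  (forall X : Top, tychonoff X -> forall (n : nat) (A : nat -> X -> Prop),
     (forall i, (i < n)%nat -> closed X (A i) /\ P (sub X (A i))) ->
     (forall i j, (i < n)%nat -> (j < n)%nat -> i <> j ->
        forall x, A i x -> A j x -> False) ->
     (forall x, exists i, (i < n)%nat /\ A i x) -> P X) /\
  (forall (X Y : Top) (f : X -> Y), tychonoff X -> tychonoff Y ->
     perfect_surj f -> P X -> P Y) /\
  (forall (X Y : Top) (f : X -> Y), tychonoff X -> tychonoff Y ->
     perfect_surj f -> P Y -> P X) /\
  (* Mrowka's condition (W) *)
  (forall (Z : Top) (p : Z) (Bs : (Z -> Prop) -> Prop), tychonoff Z ->
     open_base_at Z p Bs ->
     (forall B, Bs B -> P (sub Z (fun z => ~ B z))) -> P Z).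

Definition locally_P (P : Top -> Prop) (X : Top) : Prop :=
  forall x : X, exists U, op U /\ U x /\ P (sub X (closure X U)).

Definition stone_cech (X K : Top) (e : X -> K) : Prop :=
  compact K /\ hausdorff K /\ embedding e /\ dense K (image e) /\
  forall (Z : Top) (g : X -> Z), compact Z -> hausdorff Z -> continuous g ->
    exists G : K -> Z, continuous G /\ forall x, G (e x) = g x.

Definition compactification (X Z : Top) (z : X -> Z) : Prop :=
  compact Z /\ hausdorff Z /\ embedding z /\ dense Z (image z).

Definition cozero (X : Top) (C : X -> Prop) : Prop :=
  exists f : X -> R, rcont f /\ forall x, C x <-> f x <> 0.

(* lambda_P X inside betaX = K (X embedded via e) *)
Definition lambdaP (P : Top -> Prop) (X K : Top) (e : X -> K) (p : K) : Prop :=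
  exists C : X -> Prop, cozero X C /\ P (sub X (closure X C)) /\
    interior K (closure K (fun q => exists x, C x /\ e x = q)) p.

Definition inEP (P : Top -> Prop) (X T : Top) (j : X -> T) : Prop :=
  tychonoff T /\ embedding j /\ dense T (image j) /\ P T /\
  compact (sub T (fun t => ~ image j t)).

Definition XuE (X Z : Top) (z : X -> Z) (E : Z -> Prop) : Z -> Prop :=
  fun q => image z q \/ E q.

Definition XuE_inc (X Z : Top) (z : X -> Z) (E : Z -> Prop) (x : X)
  : sub Z (XuE X Z z E) :=
  exist _ (z x) (or_introl (ex_intro _ x eq_refl)).

(* Main.v *)
(**
  Let [Y = X ∪ E].  If [V] is an open neighbourhood of [E] in [zeta X], then [phi^-1] of the
  complement of [V] is a compact subset of [lambda_P X], so finitely many closed sets [cl_X C]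
  with [P] cover [Y \ V]; hence [Y \ V] has [P].  Collapsing the compact set [E] to a point is
  a perfect map onto a space which has [P] by Mrówka's condition (W), and [P] pulls back to [Y].

  Conversely, let [T] be an extension with [P] and compact remainder.  Identifying points
  of [beta X] which are not separated by (extensions of) continuous functions on [T] yields
  [beta T], and [E] is the remainder [T \ X].  If [phi p] is outside [E], a Urysohn function
  [f] vanishing at [phi p] and equal to [1] on [E] gives the cozero-set [C = {f < 1/2}]; its
  closure in [X] is closed in [T], so has [P], and [p] is interior to the closure of [C].

  Closed subspaces inherit [P], because [A + B -> B] is perfect when [A] is closed in [B].
*)
From Stdlib Require Import Reals Lra Lia List Arith Classical.
From Stdlib Require Import ClassicalEpsilon FunctionalExtensionality PropExtensionality ProofIrrelevance.
Require Import Defs.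

(** * Open, closed and compact sets *)

Lemma op_ext (X : Top) (U V : X -> Prop) : (forall x, U x <-> V x) -> op U -> op V.
Proof.
  intros H HU. replace V with U; [exact HU|].
  apply functional_extensionality; intro x; apply propositional_extensionality; auto.
Qed.

(** [U] is the union of the open sets it contains, so openness can be checked point by point. *)
Lemma op_local (X : Top) (U : X -> Prop) :
  (forall x, U x -> exists V, op V /\ V x /\ forall y, V y -> U y) -> op U.
Proof.
  intro H.
  apply op_ext with (fun x => exists V, (op V /\ forall y, V y -> U y) /\ V x).
  - intro x; split.
    + intros [V [[_ HV] Vx]]; auto.
    + intro Ux; destruct (H x Ux) as [V [oV [Vx HV]]]; exists V; auto.
  - apply op_union; intros V [oV _]; exact oV.
Qed.

Lemma op_empty (X : Top) : op (fun _ : X => False).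
Proof. apply op_local; intros x []. Qed.

Lemma op_or (X : Top) (U V : X -> Prop) : op U -> op V -> op (fun x => U x \/ V x).
Proof.
  intros HU HV; apply op_local; intros x [H|H].
  - exists U; auto.
  - exists V; auto.
Qed.

Lemma closed_ext (X : Top) (F G : X -> Prop) :
  (forall x, F x <-> G x) -> closed X F -> closed X G.
Proof. intros H; apply op_ext; intro x; rewrite H; tauto. Qed.

Lemma closed_or (X : Top) (F G : X -> Prop) :
  closed X F -> closed X G -> closed X (fun x => F x \/ G x).
Proof.
  intros HF HG. apply op_ext with (fun x => ~ F x /\ ~ G x); [intro x; tauto|].
  apply op_inter; assumption.
Qed.

Lemma closed_empty (X : Top) : closed X (fun _ => False).
Proof. apply op_ext with (fun _ => True); [tauto | apply op_full]. Qed.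

Lemma closed_compl (X : Top) (U : X -> Prop) : op U -> closed X (fun x => ~ U x).
Proof. apply op_ext; intro x; split; [tauto | apply NNPP]. Qed.

Lemma closed_preimage (X Y : Top) (f : X -> Y) (F : Y -> Prop) :
  continuous f -> closed Y F -> closed X (fun x => F (f x)).
Proof. intros Hf HF; exact (Hf _ HF). Qed.

Lemma closed_closure (X : Top) (A : X -> Prop) : closed X (closure X A).
Proof.
  apply op_local; intros x Hx.
  apply not_all_ex_not in Hx; destruct Hx as [F HF].
  apply imply_to_and in HF; destruct HF as [cF HF].
  apply imply_to_and in HF; destruct HF as [AF nFx].
  exists (fun y => ~ F y); repeat split; auto.
  intros y nFy Hy; apply nFy, Hy; auto.
Qed.

Lemma closure_meets (X : Top) (A : X -> Prop) (x : X) :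
  closure X A x <-> forall U, op U -> U x -> exists a, A a /\ U a.
Proof.
  split.
  - intros Hx U oU Ux. apply NNPP; intro H.
    apply (Hx (fun y => ~ U y)); auto using closed_compl.
    intros y Ay Uy; apply H; exists y; auto.
  - intros H F cF AF. apply NNPP; intro nF.
    destruct (H _ cF nF) as [a [Aa nFa]]; auto.
Qed.

Lemma sub_eq (X : Top) (A : X -> Prop) (x y : sub X A) :
  proj1_sig x = proj1_sig y -> x = y.
Proof.
  destruct x as [x hx], y as [y hy]; simpl; intro E; subst y.
  f_equal; apply proof_irrelevance.
Qed.

Lemma continuous_incl (X : Top) (A : X -> Prop) :
  continuous (fun y : sub X A => proj1_sig y : X).
Proof. intros V oV; exists V; split; [exact oV | tauto]. Qed.

Lemma sub_op_trace (X : Top) (A : X -> Prop) (U : X -> Prop) :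
  op U -> op (fun y : sub X A => U (proj1_sig y)).
Proof. apply continuous_incl. Qed.

Lemma continuous_into_sub (X Y : Top) (A : Y -> Prop) (f : X -> sub Y A) :
  continuous (fun x => proj1_sig (f x) : Y) -> continuous f.
Proof.
  intros H V [U [oU EU]]. apply op_ext with (fun x => U (proj1_sig (f x))).
  - intro x; symmetry; apply EU.
  - exact (H U oU).
Qed.

Lemma closed_sub (X : Top) (A : X -> Prop) (F : sub X A -> Prop) :
  closed (sub X A) F ->
  exists G, closed X G /\ forall y, F y <-> G (proj1_sig y).
Proof.
  intros [U [oU EU]]. exists (fun x => ~ U x); split; [apply closed_compl, oU|].
  intro y; specialize (EU y); simpl in EU. split.
  - intros Fy Uy; apply EU in Uy; auto.
  - intro nU; apply NNPP; intro nF; apply nU, EU, nF.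
Qed.

(** Covers consist of open sets of the ambient space, which avoids subtypes; [compact_sub] gives the
    link with [compact (sub X A)]. *)
Definition compact_set (X : Top) (A : X -> Prop) : Prop :=
  forall F : (X -> Prop) -> Prop, (forall U, F U -> op U) ->
    (forall x, A x -> exists U, F U /\ U x) ->
    exists l : list (X -> Prop), (forall U, In U l -> F U) /\
      forall x, A x -> exists U, In U l /\ U x.

Lemma compact_set_ext (X : Top) (A B : X -> Prop) :
  (forall x, A x <-> B x) -> compact_set X A -> compact_set X B.
Proof.
  intros H HA F oF cF. destruct (HA F oF) as [l [lF lc]].
  - intros x Ax; apply cF, H, Ax.
  - exists l; split; [exact lF|]. intros x Bx; apply lc, H, Bx.
Qed.

Lemma compact_set_full (X : Top) : compact X <-> compact_set X (fun _ => True).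
Proof.
  split; intros H F oF cF; destruct (H F oF) as [l [lF lc]]; auto;
    exists l; split; auto.
Qed.

(** The open sets satisfying [Q] cover [A], and the union of a finite subcover still satisfies [Q].
    Most compactness arguments below are instances with a suitable [Q]. *)
Lemma compact_set_ind (X : Top) (A : X -> Prop) (Q : (X -> Prop) -> Prop) :
  compact_set X A -> Q (fun _ => False) ->
  (forall U V, Q U -> Q V -> Q (fun x => U x \/ V x)) ->
  (forall x, A x -> exists U, op U /\ U x /\ Q U) ->
  exists W, op W /\ (forall x, A x -> W x) /\ Q W.
Proof.
  intros HA Q0 QU QA.
  destruct (HA (fun U => op U /\ Q U)) as [l [lF lc]].
  - intros U [oU _]; exact oU.
  - intros x Ax. destruct (QA x Ax) as [U [oU [Ux QUx]]]; eauto.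
  - assert (HL : exists W, op W /\ Q W /\ forall x, (exists U, In U l /\ U x) -> W x).
    { clear lc; induction l as [|U l IH].
      - exists (fun _ => False); repeat split; auto using op_empty.
        intros x [U [[] _]].
      - destruct IH as [W [oW [QW HW]]]; [intros; apply lF; right; auto|].
        destruct (lF U (or_introl eq_refl)) as [oU QU'].
        exists (fun x => U x \/ W x); repeat split; auto using op_or.
        intros x [V [[<-|HV] Vx]]; eauto. }
    destruct HL as [W [oW [QW HW]]]; exists W; auto.
Qed.

Lemma compact_set_image (X Y : Top) (f : X -> Y) (A : X -> Prop) :
  continuous f -> compact_set X A ->
  compact_set Y (fun y => exists x, A x /\ f x = y).
Proof.
  intros cf HA F oF cF.
  destruct (compact_set_ind X A (fun W => exists l, (forall V, In V l -> F V) /\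
      forall x, W x -> exists V, In V l /\ V (f x)) HA) as [W [_ [AW [l [lF lW]]]]].
  - exists nil; split; [intros V []|intros x []].
  - intros U V [l [lF lU]] [m [mF mV]]. exists (l ++ m); split.
    + intros W HW; apply in_app_or in HW; destruct HW; auto.
    + intros x [Ux|Vx].
      * destruct (lU x Ux) as [W [HW Wx]]; exists W; auto using in_or_app.
      * destruct (mV x Vx) as [W [HW Wx]]; exists W; auto using in_or_app.
  - intros x Ax. destruct (cF (f x)) as [V [FV Vx]]; [eauto|].
    exists (fun x => V (f x)); repeat split; [apply cf; auto|exact Vx|].
    exists (V :: nil); split; [intros U [<-|[]]; exact FV|].
    intros y Vy; exists V; simpl; auto.
  - exists l; split; [exact lF|]. intros y [x [Ax <-]]; auto.
Qed.

Lemma compact_sub (X : Top) (A : X -> Prop) : compact (sub X A) <-> compact_set X A.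
Proof.
  split.
  - intro H. apply compact_set_full in H.
    apply (compact_set_image _ _ _ _ (continuous_incl X A)) in H.
    revert H; apply compact_set_ext; intro x; split.
    + intros [[y hy] [_ <-]]; exact hy.
    + intro hx; exists (exist _ x hx); auto.
  - intros HA F oF cF.
    destruct (compact_set_ind X A (fun W => exists l, (forall V, In V l -> F V) /\
        forall x : sub X A, W (proj1_sig x) -> exists V, In V l /\ V x) HA)
      as [W [_ [AW [l [lF lW]]]]].
    + exists nil; split; [intros V []|intros x []].
    + intros U V [l [lF lU]] [m [mF mV]]. exists (l ++ m); split.
      * intros W HW; apply in_app_or in HW; destruct HW; auto.
      * intros x [Ux|Vx].
        -- destruct (lU x Ux) as [W [HW Wx]]; exists W; auto using in_or_app.
        -- destruct (mV x Vx) as [W [HW Wx]]; exists W; auto using in_or_app.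
    + intros x Ax. destruct (cF (exist _ x Ax)) as [V [FV Vx]].
      destruct (oF V FV) as [U [oU EU]].
      exists U; repeat split; [exact oU|apply EU in Vx; exact Vx|].
      exists (V :: nil); split; [intros W [<-|[]]; exact FV|].
      intros y Uy; exists V; split; [left; auto|]. apply EU, Uy.
    + exists l; split; [exact lF|]. intro x; apply lW, AW, (proj2_sig x).
Qed.

Lemma compact_set_or (X : Top) (A B : X -> Prop) :
  compact_set X A -> compact_set X B -> compact_set X (fun x => A x \/ B x).
Proof.
  intros HA HB F oF cF.
  destruct (HA F oF) as [l [lF lc]]; [auto|].
  destruct (HB F oF) as [m [mF mc]]; [auto|].
  exists (l ++ m); split.
  - intros U HU; apply in_app_or in HU; destruct HU; auto.
  - intros x [Ax|Bx].
    + destruct (lc x Ax) as [U [HU Ux]]; exists U; split; auto using in_or_app.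
    + destruct (mc x Bx) as [U [HU Ux]]; exists U; split; auto using in_or_app.
Qed.

Lemma compact_set_subsingleton (X : Top) (A : X -> Prop) :
  (forall x y, A x -> A y -> x = y) -> compact_set X A.
Proof.
  intros H F oF cF. destruct (classic (exists x, A x)) as [[x Ax]|N].
  - destruct (cF x Ax) as [U [FU Ux]]. exists (U :: nil); split.
    + intros V [<-|[]]; exact FU.
    + intros y Ay; exists U; split; [left; auto|]. rewrite (H y x); auto.
  - exists nil; split; [intros U []|]. intros x Ax; exfalso; eauto.
Qed.

Lemma compact_set_closed (X : Top) (A : X -> Prop) :
  compact X -> closed X A -> compact_set X A.
Proof.
  intros HX cA F oF cF. apply compact_set_full in HX.
  destruct (compact_set_ind X _ (fun W => exists l, (forall V, In V l -> F V) /\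
      forall x, A x -> W x -> exists V, In V l /\ V x) HX) as [W [_ [AW [l [lF lW]]]]].
  - exists nil; split; [intros V []|intros x _ []].
  - intros U V [l [lF lU]] [m [mF mV]]. exists (l ++ m); split.
    + intros W HW; apply in_app_or in HW; destruct HW; auto.
    + intros x Ax [Ux|Vx].
      * destruct (lU x Ax Ux) as [W [HW Wx]]; exists W; auto using in_or_app.
      * destruct (mV x Ax Vx) as [W [HW Wx]]; exists W; auto using in_or_app.
  - intros x _. destruct (classic (A x)) as [Ax|nA].
    + destruct (cF x Ax) as [U [FU Ux]]. exists U; repeat split; auto.
      exists (U :: nil); split; [intros W [<-|[]]; exact FU|].
      intros y _ Uy; exists U; simpl; auto.
    + exists (fun x => ~ A x); repeat split; auto.
      exists nil; split; [intros V []|]. intros y Ay nAy; contradiction.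
  - exists l; split; [exact lF|]. intros x Ax; apply lW; auto.
Qed.

Lemma compact_set_in_sub (X : Top) (A : X -> Prop) (B : sub X A -> Prop) :
  compact_set X (fun x => exists h : A x, B (exist _ x h)) -> compact_set (sub X A) B.
Proof.
  intro H. apply compact_sub in H.
  apply compact_set_full in H.
  set (S := sub X (fun x => exists h : A x, B (exist _ x h))) in *.
  assert (G : forall y : S, A (proj1_sig y)) by (intros [y [h ?]]; exact h).
  apply (compact_set_image S (sub X A) (fun y : S => exist _ (proj1_sig y) (G y))) in H.
  - revert H; apply compact_set_ext; intros [x hx]; split.
    + intros [[y [h By]] [_ E]]. apply (f_equal (@proj1_sig _ _)) in E; simpl in E; subst y.
      rewrite (proof_irrelevance _ hx h); exact By.
    + intro Bx. exists (exist _ x (ex_intro _ hx Bx)); split; [auto|].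
      apply sub_eq; reflexivity.
  - apply continuous_into_sub; simpl. apply continuous_incl.
Qed.

(** Here [Q V] asks for a neighbourhood of [x] missing [V]; a union of two sets [V] is matched by an
    intersection of neighbourhoods. *)
Lemma separate_point_compact (X : Top) (A : X -> Prop) (x : X) :
  hausdorff X -> compact_set X A -> ~ A x ->
  exists U V, op U /\ op V /\ U x /\ (forall a, A a -> V a) /\ forall z, U z -> V z -> False.
Proof.
  intros HX HA nA.
  destruct (compact_set_ind X A (fun V => exists U, op U /\ U x /\ forall z, U z -> V z -> False)
    HA) as [V [oV [AV [U [oU [Ux D]]]]]].
  - exists (fun _ => True); auto using op_full.
  - intros V V' [U [oU [Ux D]]] [U' [oU' [Ux' D']]].
    exists (fun z => U z /\ U' z); repeat split; auto using op_inter.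
    intros z [Uz Uz'] [Vz|Vz]; eauto.
  - intros a Aa. destruct (HX x a) as [U [V [oU [oV [Ux [Va D]]]]]]; [intros ->; contradiction|].
    exists V; repeat split; auto. exists U; auto.
  - exists U, V; auto.
Qed.

Lemma closed_compact_set (X : Top) (A : X -> Prop) :
  hausdorff X -> compact_set X A -> closed X A.
Proof.
  intros HX HA; apply op_local; intros x nA.
  destruct (separate_point_compact X A x HX HA nA) as [U [V [oU [_ [Ux [AV D]]]]]].
  exists U; repeat split; auto. intros y Uy Ay; eauto.
Qed.

Lemma closed_point (X : Top) (x : X) : hausdorff X -> closed X (fun y => y = x).
Proof.
  intro HX; apply closed_compact_set; [exact HX|].
  apply compact_set_subsingleton; intros; congruence.
Qed.

Lemma compact_hausdorff_normal (X : Top) (A B : X -> Prop) :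
  compact X -> hausdorff X -> closed X A -> closed X B ->
  (forall x, A x -> B x -> False) ->
  exists U V, op U /\ op V /\ (forall x, A x -> U x) /\ (forall x, B x -> V x) /\
    forall z, U z -> V z -> False.
Proof.
  intros KX HX cA cB D.
  assert (KA := compact_set_closed X A KX cA).
  assert (KB := compact_set_closed X B KX cB).
  destruct (compact_set_ind X A (fun U => exists V, op V /\ (forall b, B b -> V b) /\
      forall z, U z -> V z -> False) KA) as [U [oU [AU [V [oV [BV E]]]]]].
  - exists (fun _ => True); auto using op_full.
  - intros U U' [V [oV [BV E]]] [V' [oV' [BV' E']]].
    exists (fun z => V z /\ V' z); repeat split; auto using op_inter.
    intros z [Uz|Uz] [Vz Vz']; eauto.
  - intros a Aa.
    destruct (separate_point_compact X B a HX KB) as [U [V [oU [oV [Ua [BV E]]]]]]; [eauto|].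
    exists U; repeat split; auto. exists V; auto.
  - exists U, V; auto.
Qed.

(** * Real-valued functions and complete regularity *)

Lemma rcont_ball (X : Top) (f : X -> R) (c r : R) :
  rcont f -> op (fun x => Rabs (f x - c) < r).
Proof.
  intro cf; apply op_local; intros x Hx.
  destruct (cf x (r - Rabs (f x - c))) as [U [oU [Ux HU]]]; [lra|].
  exists U; repeat split; auto. intros y Uy; specialize (HU y Uy).
  replace (f y - c) with ((f y - f x) + (f x - c)) by ring.
  pose proof (Rabs_triang (f y - f x) (f x - c)); lra.
Qed.

Lemma rcont_lt (X : Top) (f : X -> R) (c : R) : rcont f -> op (fun x => f x < c).
Proof.
  intro cf; apply op_local; intros x Hx.
  destruct (cf x (c - f x)) as [U [oU [Ux HU]]]; [lra|].
  exists U; repeat split; auto. intros y Uy; specialize (HU y Uy).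
  apply Rabs_def2 in HU; lra.
Qed.

Lemma rcont_lipschitz (X : Top) (f : X -> R) (u : R -> R) (L : R) :
  0 < L -> (forall a b, Rabs (u a - u b) <= L * Rabs (a - b)) ->
  rcont f -> rcont (fun x => u (f x)).
Proof.
  intros HL Hu cf x eps He.
  destruct (cf x (eps / L)) as [U [oU [Ux HU]]]; [apply Rdiv_lt_0_compat; auto|].
  exists U; repeat split; auto. intros y Uy; specialize (HU y Uy).
  apply Rle_lt_trans with (1 := Hu _ _).
  replace eps with (L * (eps / L)) by (field; lra).
  apply Rmult_lt_compat_l; auto.
Qed.

Ltac solve_minmax :=
  unfold Rmin, Rmax, Rabs in *;
  repeat match goal with
  | |- context [Rle_dec ?a ?b] => destruct (Rle_dec a b)
  | _ : context [Rle_dec ?a ?b] |- _ => destruct (Rle_dec a b)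
  | |- context [Rcase_abs ?a] => destruct (Rcase_abs a)
  end; lra.

Definition clamp (r : R) : R := Rmin 1 (Rmax 0 r).

Lemma clamp_range (r : R) : 0 <= clamp r <= 1.
Proof. unfold clamp; solve_minmax. Qed.

Lemma clamp_nonpos (r : R) : r <= 0 -> clamp r = 0.
Proof. intro; unfold clamp; solve_minmax. Qed.

Lemma clamp_ge1 (r : R) : 1 <= r -> clamp r = 1.
Proof. intro; unfold clamp; solve_minmax. Qed.

Lemma rcont_clamp (X : Top) (f : X -> R) (a b : R) :
  rcont f -> rcont (fun x => clamp (a * f x + b)).
Proof.
  assert (H0 := Rabs_pos a).
  (* The Lipschitz constant is raised to [1 + Rabs a] because it has to be positive even when
     [a = 0]. *)
  apply (rcont_lipschitz X f (fun r => clamp (a * r + b)) (1 + Rabs a)); [lra|].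
  intros r s.
  apply Rle_trans with (Rabs (a * (r - s))).
  - replace (a * (r - s)) with ((a * r + b) - (a * s + b)) by ring.
    generalize (a * r + b), (a * s + b); intros u v; unfold clamp; solve_minmax.
  - rewrite Rabs_mult. apply Rmult_le_compat_r; [apply Rabs_pos|lra].
Qed.

Lemma rcont_min (X : Top) (f g : X -> R) :
  rcont f -> rcont g -> rcont (fun x => Rmin (f x) (g x)).
Proof.
  intros cf cg x eps He.
  destruct (cf x eps He) as [U [oU [Ux HU]]], (cg x eps He) as [V [oV [Vx HV]]].
  exists (fun y => U y /\ V y); repeat split; auto using op_inter.
  intros y [Uy Vy]; specialize (HU y Uy); specialize (HV y Vy).
  apply Rabs_def2 in HU; apply Rabs_def2 in HV. unfold Rmin.
  destruct (Rle_dec (f y) (g y)), (Rle_dec (f x) (g x)); apply Rabs_def1; lra.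
Qed.

Lemma rcont_const (X : Top) (c : R) : rcont (fun _ : X => c).
Proof.
  intros x eps He; exists (fun _ => True); repeat split; [apply op_full|].
  intros; rewrite Rminus_diag, Rabs_R0; exact He.
Qed.

Lemma rcont_comp (X Y : Top) (h : X -> Y) (f : Y -> R) :
  continuous h -> rcont f -> rcont (fun x => f (h x)).
Proof.
  intros ch cf x eps He. destruct (cf (h x) eps He) as [U [oU [Ux HU]]].
  exists (fun x => U (h x)); repeat split; auto.
Qed.

Lemma tychonoff_of_closed_points (X : Top) :
  completely_regular X -> (forall x : X, closed X (fun y => y = x)) -> tychonoff X.
Proof.
  intros CR HP; split; [exact CR|]. intros x y Hxy.
  destruct (CR _ x (HP y) Hxy) as [f [cf [fx fy]]].
  exists (fun z => f z < 1/2), (fun z => Rabs (f z - 1) < 1/2); repeat split.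
  - apply rcont_lt, cf.
  - apply rcont_ball, cf.
  - rewrite fx; lra.
  - rewrite (fy y eq_refl). rewrite Rminus_diag, Rabs_R0; lra.
  - intros z H1 H2; apply Rabs_def2 in H2; lra.
Qed.

Lemma tychonoff_embedding (X Y : Top) (f : X -> Y) :
  embedding f -> tychonoff Y -> tychonoff X.
Proof.
  intros [inj [cf of]] [CR HY]. apply tychonoff_of_closed_points.
  - intros F x cF nF. destruct (of _ cF) as [V [oV EV]].
    destruct (CR (fun y => ~ V y) (f x)) as [g [cg [gx gF]]].
    + apply closed_compl, oV.
    + intro H; apply H, EV, nF.
    + exists (fun x => g (f x)); repeat split; [apply rcont_comp; auto|exact gx|].
      intros y Fy; apply gF; intro Vy; apply EV in Vy; auto.
  - intro x. apply closed_ext with (fun y => f y = f x).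
    + intro y; split; [apply inj | congruence].
    + apply (closed_preimage X Y f (fun y => y = f x) cf), closed_point, HY.
Qed.

Lemma embedding_incl (X : Top) (A : X -> Prop) :
  embedding (fun y : sub X A => proj1_sig y : X).
Proof.
  repeat split.
  - intros x y; apply sub_eq.
  - apply continuous_incl.
  - intros U [V [oV EV]]; exists V; auto.
Qed.

Lemma tychonoff_sub (X : Top) (A : X -> Prop) : tychonoff X -> tychonoff (sub X A).
Proof. apply tychonoff_embedding with (1 := embedding_incl X A). Qed.

(** Single points of [A] are separated from [F], and minima handle finite unions. On open pieces
    only values below 1/2 can be asked for, since a function vanishing at a point need not vanish
    nearby. *)
Lemma separate_compact_closed (X : Top) (A F : X -> Prop) :
  completely_regular X -> compact_set X A -> closed X F ->
  (forall x, A x -> F x -> False) ->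
  exists f : X -> R, rcont f /\ (forall x, A x -> f x = 0) /\ forall x, F x -> f x = 1.
Proof.
  intros CR KA cF D.
  destruct (compact_set_ind X A (fun U => exists f : X -> R, rcont f /\
      (forall x, U x -> f x < 1/2) /\ forall x, F x -> f x = 1) KA)
    as [U [_ [AU [f [cf [fU fF]]]]]].
  - exists (fun _ => 1); repeat split; [apply rcont_const|intros x []].
  - intros U V [f [cf [fU fF]]] [g [cg [gV gF]]].
    exists (fun x => Rmin (f x) (g x)); repeat split; [apply rcont_min; auto| |].
    + intros x [Ux|Vx].
      * specialize (fU x Ux); solve_minmax.
      * specialize (gV x Vx); solve_minmax.
    + intros x Fx; rewrite fF, gF; auto; solve_minmax.
  - intros a Aa. destruct (CR F a cF) as [f [cf [fa fF]]]; [eauto|].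
    exists (fun x => f x < 1/2); repeat split; [apply rcont_lt, cf|lra|].
    exists f; auto.
  (* The truncation of [2 r - 1] sends values below 1/2 to 0 and fixes 1. *)
  - exists (fun x => clamp (2 * f x + -1)); repeat split; [apply rcont_clamp; auto| |].
    + intros x Ax; apply clamp_nonpos. specialize (fU x (AU x Ax)); lra.
    + intros x Fx; apply clamp_ge1. rewrite fF; auto; lra.
Qed.

(** * Urysohn's lemma *)

Section Urysohn.
Variable X : Top.
Hypothesis (KX : compact X) (HX : hausdorff X).

(** Equivalent to the closure of [U] lying in [V]; an intermediate closed set is easier to
    supply. *)
Definition below (U V : X -> Prop) : Prop :=
  exists C, closed X C /\ (forall x, U x -> C x) /\ forall x, C x -> V x.

Lemma below_subset (U V : X -> Prop) (x : X) : below U V -> U x -> V x.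
Proof. intros [C [_ [UC CV]]] Ux; auto. Qed.

Lemma closed_in_open (C V : X -> Prop) :
  closed X C -> op V -> (forall x, C x -> V x) ->
  exists W, op W /\ (forall x, C x -> W x) /\ below W V.
Proof.
  intros cC oV CV.
  destruct (compact_hausdorff_normal X C (fun x => ~ V x) KX HX cC (closed_compl X V oV))
    as [W [W' [oW [oW' [CW [VW' D]]]]]]; [auto|].
  exists W; repeat split; auto. exists (fun x => ~ W' x); repeat split.
  - apply closed_compl, oW'.
  - intros x Wx W'x; eauto.
  - intros x nW; apply NNPP; intro nV; auto.
Qed.

Lemma below_interpolate (U V : X -> Prop) :
  op V -> below U V -> exists W, op W /\ below U W /\ below W V.
Proof.
  intros oV [C [cC [UC CV]]]. destruct (closed_in_open C V cC oV CV) as [W [oW [CW HW]]].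
  exists W; repeat split; auto. exists C; auto.
Qed.

(** A chosen interpolant. [epsilon] makes the choice total, so that [dyadic] is a plain recursion;
    [dyadic_spec] recovers the properties from [below_interpolate]. *)
Definition between (U V : X -> Prop) : X -> Prop :=
  epsilon (inhabits U) (fun W => op W /\ below U W /\ below W V).

Variable D0 : nat -> X -> Prop.
Hypothesis D0_op : forall k, op (D0 k).
Hypothesis D0_below : forall k, below (D0 k) (D0 (S k)).

(* [dyadic n k] is the open set attached to the dyadic rational [k / 2^n]. *)
Fixpoint dyadic (n k : nat) : X -> Prop :=
  match n with
  | O => D0 k
  | S n => if Nat.even k then dyadic n (Nat.div2 k)
           else between (dyadic n (Nat.div2 k)) (dyadic n (S (Nat.div2 k)))
  end.

Lemma dyadic_double (n k : nat) : dyadic (S n) (2 * k) = dyadic n k.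
Proof. cbn [dyadic]. rewrite Nat.even_even, Nat.div2_double; reflexivity. Qed.

Lemma dyadic_succ_double (n k : nat) :
  dyadic (S n) (S (2 * k)) = between (dyadic n k) (dyadic n (S k)).
Proof.
  cbn [dyadic]. rewrite Nat.even_succ, Nat.odd_even, Nat.div2_succ_double; reflexivity.
Qed.

(** Level [S n] keeps the old sets at even indices and places an interpolant at each odd index, so
    every new consecutive pair is half of an old gap. *)
Lemma dyadic_spec (n k : nat) : op (dyadic n k) /\ below (dyadic n k) (dyadic n (S k)).
Proof.
  revert k; induction n as [|n IH]; intro k; [split; [apply D0_op|apply D0_below]|].
  assert (HB : forall m, op (between (dyadic n m) (dyadic n (S m))) /\
     below (dyadic n m) (between (dyadic n m) (dyadic n (S m))) /\
     below (between (dyadic n m) (dyadic n (S m))) (dyadic n (S m))).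
  { intro m. apply (epsilon_spec (inhabits (dyadic n m))
      (fun W => op W /\ below (dyadic n m) W /\ below W (dyadic n (S m)))).
    apply below_interpolate; apply IH. }
  destruct (Nat.Even_or_Odd k) as [[m ->]|[m ->]].
  - rewrite dyadic_succ_double, dyadic_double. split; [apply IH|apply HB].
  - replace (S (2 * m + 1)) with (2 * S m)%nat by lia. rewrite Nat.add_1_r.
    rewrite dyadic_succ_double, dyadic_double. split; apply HB.
Qed.

Lemma dyadic_mono (n k l : nat) (x : X) : (k <= l)%nat -> dyadic n k x -> dyadic n l x.
Proof.
  intro H; induction H as [|l _ IH]; auto.
  intro Hx; apply (below_subset _ _ x (proj2 (dyadic_spec n l))); auto.
Qed.

(** The set depends only on the rational number, not on the fraction that represents it. *)
Lemma dyadic_refine (m n k : nat) : dyadic (m + n) (2 ^ m * k) = dyadic n k.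
Proof.
  induction m as [|m IH]; [simpl; rewrite Nat.add_0_r; reflexivity|].
  rewrite Nat.pow_succ_r', <- Nat.mul_assoc. rewrite Nat.add_succ_l, dyadic_double; exact IH.
Qed.

(** By contraposition: over the common denominator [2 ^ (m + n)] a smaller fraction has a smaller
    index, and [dyadic_mono] applies. *)
Lemma dyadic_value_le (n k m l : nat) (x : X) :
  dyadic n k x -> ~ dyadic m l x -> INR l / 2 ^ m <= INR k / 2 ^ n.
Proof.
  intros Hk Hl. apply Rnot_lt_le; intro H; apply Hl.
  assert (Pn : 0 < 2 ^ n) by (apply pow_lt; lra).
  assert (Pm : 0 < 2 ^ m) by (apply pow_lt; lra).
  rewrite <- (dyadic_refine m) in Hk. rewrite <- (dyadic_refine n), (Nat.add_comm n m).
  revert Hk; apply dyadic_mono, INR_le. rewrite !mult_INR, !pow_INR; simpl INR.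
  replace (1 + 1) with 2 by ring.
  apply Rmult_lt_compat_r with (r := 2 ^ n * 2 ^ m) in H; [|apply Rmult_lt_0_compat; auto].
  field_simplify in H; lra.
Qed.

Hypothesis D0_full : forall x, D0 2 x.

(* [f x = sup {k / 2^n | x is not in dyadic n k}] *)
Lemma urysohn_function :
  exists f : X -> R, rcont f /\ (forall x, D0 0 x -> f x <= 0) /\
    forall x, ~ D0 1 x -> 1 <= f x.
Proof.
  assert (HF : forall x, exists r, is_lub (fun v => v = 0 \/
      exists n k, v = INR k / 2 ^ n /\ ~ dyadic n k x) r).
  { intro x. apply ex_of_sig. apply completeness.
    (* The whole space is [D0 2], so no value exceeds 2. *)
    - exists 2. intros v [->|[n [k [-> H]]]]; [lra|].
      assert (G := dyadic_value_le 0 2 n k x (D0_full x) H). simpl in G; lra.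
    - exists 0; left; reflexivity. }
  assert (HF' : exists f : X -> R, forall x, is_lub (fun v => v = 0 \/
      exists n k, v = INR k / 2 ^ n /\ ~ dyadic n k x) (f x)).
  { exists (fun x => proj1_sig (constructive_indefinite_description _ (HF x))).
    intro x; apply proj2_sig. }
  clear HF; destruct HF' as [f Hf].
  assert (Hlow : forall n k x, ~ dyadic n k x -> INR k / 2 ^ n <= f x).
  { intros n k x H. apply (Hf x). right; eauto. }
  assert (Hpos : forall x, 0 <= f x) by (intro x; apply (Hf x); auto).
  assert (Hup : forall n k x, dyadic n k x -> f x <= INR k / 2 ^ n).
  { intros n k x H. apply (Hf x). intros v [->|[m [l [-> Hl]]]].
    - apply Rmult_le_pos; [apply pos_INR|left; apply Rinv_0_lt_compat, pow_lt; lra].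
    - eapply dyadic_value_le; eauto. }
  exists f; repeat split.
  - intros x eps He.
    (* The level [n] is fine enough that two steps stay below [eps]; at this level the least index
       whose set contains [x] is used. *)
    destruct (pow_lt_1_zero (1/2)) with (y := eps / 2) as [n Hn];
      [rewrite Rabs_right; lra|lra|].
    specialize (Hn n (le_n n)).
    assert (Pn : 0 < / 2 ^ n) by (apply Rinv_0_lt_compat, pow_lt; lra).
    assert (Hn' : / 2 ^ n < eps / 2).
    { unfold Rdiv in Hn at 1; rewrite Rmult_1_l, pow_inv, Rabs_right in Hn; lra. }
    assert (Hmin : exists k, dyadic n k x /\ forall l, (l < k)%nat -> ~ dyadic n l x).
    { assert (Hk : exists k, dyadic n k x).
      { exists (2 ^ n * 2)%nat. rewrite <- (Nat.add_0_r n) at 1.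
        rewrite dyadic_refine; apply D0_full. }
      apply dec_inh_nat_subset_has_unique_least_element in Hk; [|intro; apply classic].
      destruct Hk as [k [[Hk Hl] _]]. exists k; split; auto.
      intros l Hlk Hx; apply Hl in Hx; lia. }
    destruct Hmin as [k [Hk Hmin]].
    assert (Uk := Hup n k x Hk).
    (* For least index 0 or 1 there is no set two steps lower, and [0 <= f] supplies the lower
       estimate instead. *)
    destruct k as [|[|k]].
    + exists (dyadic n 0); repeat split; [apply dyadic_spec|auto|].
      intros y Hy; specialize (Hup n _ y Hy). simpl in *.
      unfold Rdiv in *; rewrite Rmult_0_l in *.
      specialize (Hpos x) as Px; specialize (Hpos y). apply Rabs_def1; lra.
    + exists (dyadic n 1); repeat split; [apply dyadic_spec|auto|].
      intros y Hy; specialize (Hup n _ y Hy). simpl in *.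
      unfold Rdiv in *; rewrite Rmult_1_l in *.
      specialize (Hpos x) as Px; specialize (Hpos y). apply Rabs_def1; lra.
    (* By minimality [x] is outside the set of index [S k], hence outside [C]. Off [C] a point
       avoids the set of index [k], so on this neighbourhood [f] stays between [k / 2^n] and
       [(k + 2) / 2^n]. *)
    + destruct (proj2 (dyadic_spec n k)) as [C [cC [DC CD]]].
      exists (fun y => dyadic n (S (S k)) y /\ ~ C y); repeat split.
      * apply op_inter; [apply dyadic_spec|exact cC].
      * exact Hk.
      * intro Cx; apply (Hmin (S k)); auto.
      * intros y [Hy nC]. specialize (Hup n _ y Hy).
        assert (Ly := Hlow n k y (fun H => nC (DC y H))).
        assert (Lx := Hlow n (S k) x (Hmin (S k) (Nat.lt_succ_diag_r _))).
        rewrite !S_INR in *. unfold Rdiv in *.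
        rewrite !Rmult_plus_distr_r in *. apply Rabs_def1; lra.
  - intros x Hx. apply (Hf x). intros v [->|[m [l [-> Hl]]]]; [lra|].
    assert (G := dyadic_value_le 0 0 m l x Hx Hl). simpl in G; lra.
  - intros x Hx. assert (G := Hlow 0%nat 1%nat x Hx). simpl in G; lra.
Qed.

End Urysohn.

(** The sequence [D0] starts with a neighbourhood of [x], continues with the complement of [F], and
    is the whole space from index 2 on; truncating the Urysohn function gives the exact values 0 and
    1. *)
Lemma tychonoff_compact_hausdorff (X : Top) : compact X -> hausdorff X -> tychonoff X.
Proof.
  intros KX HX; split; [|exact HX]. intros F x cF nF.
  destruct (closed_in_open X KX HX (fun y => y = x) (fun y => ~ F y)) as [U [oU [xU HU]]];
    [apply closed_point, HX|exact cF|intros y ->; exact nF|].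
  destruct (urysohn_function X KX HX
    (fun k => match k with 0%nat => U | 1%nat => fun y => ~ F y | _ => fun _ => True end))
    as [f [cf [f0 f1]]].
  - intros [|[|k]]; auto using op_full.
  - intros [|[|k]]; [exact HU| |];
      exists (fun _ => True); repeat split; auto;
      apply op_ext with (fun _ => False); auto using op_empty; tauto.
  - auto.
  - exists (fun y => clamp (1 * f y + 0)); repeat split.
    + apply rcont_clamp, cf.
    + apply clamp_nonpos. specialize (f0 x (xU x eq_refl)); lra.
    + intros y Fy; apply clamp_ge1. specialize (f1 y (fun H => H Fy)); lra.
Qed.

(** * Extending bounded functions to the Stone-Cech compactification *)

Definition real_op (U : R -> Prop) : Prop :=
  forall x, U x -> exists eps, 0 < eps /\ forall y, Rabs (y - x) < eps -> U y.

(** The line as a [Top]: the extension property in [stone_cech] concerns continuous maps between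
    spaces, whereas [rcont] is an epsilon condition. *)
Definition real_top : Top.
Proof.
  refine {| pt := R; op := real_op |}.
  - intros x _; exists 1; split; [lra|auto].
  - intros U V HU HV x [Ux Vx].
    destruct (HU x Ux) as [a [Ha Ua]], (HV x Vx) as [b [Hb Vb]].
    exists (Rmin a b); split; [solve_minmax|].
    intros y Hy; split; [apply Ua|apply Vb]; revert Hy; unfold Rmin; destruct (Rle_dec a b); lra.
  - intros F HF x [U [FU Ux]]. destruct (HF U FU x Ux) as [a [Ha Ua]].
    exists a; split; [exact Ha|]. intros y Hy; exists U; auto.
Defined.

Lemma rcont_continuous (X : Top) (f : X -> R) :
  rcont f <-> continuous (f : X -> real_top).
Proof.
  split.
  - intros cf V oV. apply op_local; intros x Vx.
    destruct (oV _ Vx) as [eps [He HV]]. destruct (cf x eps He) as [U [oU [Ux HU]]].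
    exists U; repeat split; auto.
  - intros cf x eps He. exists (fun y => Rabs (f y - f x) < eps); repeat split; auto.
    + apply (cf (fun r => Rabs (r - f x) < eps)). intros r Hr.
      exists (eps - Rabs (r - f x)); split; [lra|]. intros s Hs.
      replace (s - f x) with ((s - r) + (r - f x)) by ring.
      pose proof (Rabs_triang (s - r) (r - f x)); lra.
    + rewrite Rminus_diag, Rabs_R0; exact He.
Qed.

Lemma tychonoff_real_top : tychonoff real_top.
Proof.
  apply tychonoff_of_closed_points.
  - intros F x cF nF. destruct (cF x nF) as [eps [He HF]].
    exists (fun y => clamp (/ eps * Rabs (y - x) + 0)); repeat split.
    + apply rcont_clamp. apply (rcont_lipschitz real_top (fun y => y)
        (fun y => Rabs (y - x)) 1); [lra| |].
      * intros a b; solve_minmax.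
      * apply rcont_continuous. intros V oV; exact oV.
    + rewrite Rminus_diag, Rabs_R0. apply clamp_nonpos; lra.
    + intros y Fy; apply clamp_ge1. rewrite Rplus_0_r.
      apply Rmult_le_reg_l with eps; [exact He|].
      rewrite <- Rmult_assoc, Rinv_r, Rmult_1_l, Rmult_1_r by lra.
      apply Rnot_lt_le; intro H; apply (HF y H Fy).
  - intros x y Hy. exists (Rabs (y - x)); split; [apply Rabs_pos_lt; lra|].
    intros z Hz ->. rewrite Rabs_minus_sym in Hz; lra.
Qed.

(** Let [m] be the supremum of the [a] for which [[0, a]] has a finite subcover. A member of [F]
    around [m] carries a subcover beyond [m], so the process cannot stop before 1. *)
Lemma compact_unit_interval : compact_set real_top (fun r => 0 <= r <= 1).
Proof.
  intros F oF cF.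
  set (S := fun a => 0 <= a <= 1 /\ exists l, (forall U, In U l -> F U) /\
                  forall r, 0 <= r <= a -> exists U, In U l /\ U r).
  assert (S0 : S 0).
  { split; [lra|]. destruct (cF 0) as [U [FU U0]]; [lra|]. exists (U :: nil); split.
    - intros V [<-|[]]; exact FU.
    - intros r Hr. exists U; split; [left; auto|]. replace r with 0 by lra; exact U0. }
  destruct (completeness S) as [m [Um Lm]].
  - exists 1; intros a [Ha _]; lra.
  - exists 0; exact S0.
  - assert (Hm : 0 <= m <= 1).
    { split; [apply Um, S0|]. apply Lm; intros a [Ha _]; lra. }
    destruct (cF m Hm) as [U [FU Uxm]]. destruct (oF U FU m Uxm) as [eps [He HU]].
    assert (Ha : exists a, S a /\ m - eps < a).
    { apply NNPP; intro N. assert (m <= m - eps); [|lra].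
      apply Lm; intros a Sa. apply Rnot_lt_le; intro H; apply N; eauto. }
    destruct Ha as [a [[Ha [l [lF lc]]] Hma]].
    assert (ext : forall b, 0 <= b <= 1 -> b < m + eps -> S b).
    { intros b Hb Hbm. split; [exact Hb|]. exists (U :: l); split.
      - intros V [<-|HV]; auto.
      - intros r Hr. destruct (Rle_dec r a) as [Hra|Hra].
        + destruct (lc r) as [V [HV Vr]]; [lra|]. exists V; simpl; auto.
        + exists U; split; [left; auto|]. apply HU, Rabs_def1; lra. }
    destruct (Rle_dec 1 (m + eps / 2)) as [H1|H1].
    + destruct (ext 1) as [_ Hl]; [lra|lra|exact Hl].
    + assert (S (m + eps / 2)) as H by (apply ext; lra). apply Um in H; lra.
Qed.

Lemma stone_cech_extend (X K : Top) (e : X -> K) (g : X -> R) :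
  stone_cech X K e -> rcont g -> (forall x, 0 <= g x <= 1) ->
  exists H : K -> R, rcont H /\ forall x, H (e x) = g x.
Proof.
  intros [_ [_ [_ [_ ext]]]] cg Hg.
  destruct (ext (sub real_top (fun r => 0 <= r <= 1)) (fun x => exist _ (g x) (Hg x)))
    as [G [cG EG]].
  - apply compact_sub, compact_unit_interval.
  - apply tychonoff_sub, tychonoff_real_top.
  - apply continuous_into_sub, rcont_continuous, cg.
  - exists (fun k => proj1_sig (G k)); split.
    + apply rcont_continuous. intros V oV; apply (cG _ (sub_op_trace _ _ V oV)).
    + intro x; rewrite EG; reflexivity.
Qed.

(** * Topological sums and perfect maps *)

Definition sum_op (A B : Top) (U : A + B -> Prop) : Prop :=
  op (fun a => U (inl a)) /\ op (fun b => U (inr b)).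

Definition sum_top (A B : Top) : Top.
Proof.
  refine {| pt := (A + B)%type; op := sum_op A B |}.
  - split; apply op_full.
  - intros U V [UA UB] [VA VB]; split.
    + exact (op_inter A _ _ UA VA).
    + exact (op_inter B _ _ UB VB).
  - intros F HF; split; apply op_local; intros x [U [FU Ux]]; destruct (HF U FU) as [oA oB].
    + exists (fun a => U (inl a)); repeat split; eauto.
    + exists (fun b => U (inr b)); repeat split; eauto.
Defined.

Lemma rcont_sum (A B : Top) (f : A -> R) (g : B -> R) :
  rcont f -> rcont g ->
  rcont (fun s : sum_top A B => match s with inl a => f a | inr b => g b end).
Proof.
  intros cf cg. apply rcont_continuous. intros V oV; split.
  - apply (proj1 (rcont_continuous A f) cf V oV).
  - apply (proj1 (rcont_continuous B g) cg V oV).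
Qed.

Lemma tychonoff_sum (A B : Top) : tychonoff A -> tychonoff B -> tychonoff (sum_top A B).
Proof.
  intros [CA HA] [CB HB]. apply tychonoff_of_closed_points.
  - intros F [a|b] [FA FB] nF.
    + destruct (CA (fun a => F (inl a)) a FA nF) as [f [cf [f0 f1]]].
      exists (fun s => match s with inl a => f a | inr _ => 1 end); repeat split; auto.
      * apply rcont_sum; [exact cf|apply rcont_const].
      * intros [a'|b'] Hy; auto.
    + destruct (CB (fun b => F (inr b)) b FB nF) as [f [cf [f0 f1]]].
      exists (fun s => match s with inl _ => 1 | inr b => f b end); repeat split; auto.
      * apply rcont_sum; [apply rcont_const|exact cf].
      * intros [a'|b'] Hy; auto.
  - intros [a|b]; split; simpl.
    + apply (closed_ext A (fun y => y = a)); [|apply closed_point, HA].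
      intro x; split; congruence.
    + apply op_ext with (fun _ => True); [|apply op_full]. intro; split; [discriminate|auto].
    + apply op_ext with (fun _ => True); [|apply op_full]. intro; split; [discriminate|auto].
    + apply (closed_ext B (fun y => y = b)); [|apply closed_point, HB].
      intro x; split; congruence.
Qed.

Lemma perfect_bijection (A B : Top) (f : A -> B) :
  continuous f -> closed_map f -> (forall x y, f x = f y -> x = y) ->
  (forall y, exists x, f x = y) -> perfect_surj f.
Proof.
  intros cf clf inj sur; repeat split; auto. intro y; apply compact_sub.
  apply compact_set_subsingleton; intros; apply inj; congruence.
Qed.

(** A fibre has at most one point in each summand, and the image of a closed set is the union of two
    closed images. *)
Lemma perfect_sum (A B C : Top) (f : A -> C) (g : B -> C) :
  continuous f -> closed_map f -> (forall x y, f x = f y -> x = y) ->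
  continuous g -> closed_map g -> (forall x y, g x = g y -> x = y) ->
  (forall y, (exists a, f a = y) \/ exists b, g b = y) ->
  perfect_surj (fun s : sum_top A B => match s with inl a => f a | inr b => g b end).
Proof.
  intros cf clf injf cg clg injg sur; repeat split.
  - exact (cf V H).
  - exact (cg V H).
  - intros F [FA FB].
    apply closed_ext with (fun y => (exists a, F (inl a) /\ f a = y) \/
                                    (exists b, F (inr b) /\ g b = y)).
    + intro y; split.
      * intros [[a [Fa E]]|[b [Fb E]]]; [exists (inl a)|exists (inr b)]; auto.
      * intros [[a|b] [Fs E]]; eauto.
    + apply closed_or; [apply clf, FA|apply clg, FB].
  - intro y; destruct (sur y) as [[a E]|[b E]]; [exists (inl a)|exists (inr b)]; auto.
  - intro y; apply compact_sub.
    apply compact_set_ext with (fun s : sum_top A B =>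
      (match s with inl a => f a = y | inr _ => False end) \/
      (match s with inl _ => False | inr b => g b = y end)).
    + intros [a|b]; tauto.
    + apply compact_set_or; apply compact_set_subsingleton; intros [a|b] [a'|b'];
        try contradiction; intros; f_equal; [apply injf|apply injg]; congruence.
Qed.

(** The domain is the full preimage of [S]: fibres are unchanged, and the image of the trace of a
    closed [G] is the trace of the image of [G]. *)
Lemma perfect_restrict (X Y : Top) (f : X -> Y) (S : Y -> Prop) :
  perfect_surj f ->
  perfect_surj (fun x : sub X (fun x => S (f x)) =>
                  exist _ (f (proj1_sig x)) (proj2_sig x) : sub Y S).
Proof.
  intros [cf [clf [sur Kf]]]; repeat split.
  - apply continuous_into_sub; simpl. intros V oV.
    apply (sub_op_trace X _ (fun x => V (f x))), cf, oV.
  - intros F cF. apply closed_sub in cF; destruct cF as [G [cG EG]].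
    apply closed_ext with (fun y : sub Y S => exists x, G x /\ f x = proj1_sig y).
    + intros [y Sy]; simpl; split.
      * intros [x [Gx E]]. subst y. exists (exist _ x Sy); split; [apply EG, Gx|].
        apply sub_eq; reflexivity.
      * intros [[x Sx] [Fx E]]. apply EG in Fx. exists x; split; [exact Fx|].
        apply (f_equal (@proj1_sig _ _)) in E; exact E.
    + apply (closed_preimage _ _ _ _ (continuous_incl Y S) (clf G cG)).
  - intros [y Sy]. destruct (sur y) as [x E]; subst y.
    exists (exist _ x Sy); apply sub_eq; reflexivity.
  - intros [y Sy]. apply compact_sub, compact_set_in_sub.
    apply compact_set_ext with (fun x => f x = y).
    + intro x; split.
      * intro E; subst y. exists Sy; apply sub_eq; reflexivity.
      * intros [h E]. apply (f_equal (@proj1_sig _ _)) in E; exact E.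
    + apply compact_sub, Kf.
Qed.

Lemma closed_map_incl (X : Top) (A : X -> Prop) :
  closed X A -> closed_map (fun y : sub X A => proj1_sig y : X).
Proof.
  intros cA F cF. apply closed_sub in cF; destruct cF as [G [cG EG]].
  apply op_ext with (fun x => ~ A x \/ ~ G x); [|apply op_or; auto].
  intro x; split.
  - intros H [[y Ay] [Fy <-]]. apply EG in Fy; simpl in *; tauto.
  - intro H. destruct (classic (A x)) as [Ax|]; [|auto]. right; intro Gx.
    apply H; exists (exist _ x Ax); split; [apply EG, Gx|reflexivity].
Qed.

Definition sub_mono (X : Top) (A B : X -> Prop) (h : forall x, A x -> B x)
  (s : sub X A) : sub X B := exist _ (proj1_sig s) (h _ (proj2_sig s)).

Lemma sub_mono_closed_embedding (X : Top) (A B : X -> Prop) (h : forall x, A x -> B x) :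
  closed X A ->
  continuous (sub_mono X A B h) /\ closed_map (sub_mono X A B h) /\
  forall x y, sub_mono X A B h x = sub_mono X A B h y -> x = y.
Proof.
  intro cA; repeat split.
  - apply continuous_into_sub, continuous_incl.
  - intros F cF.
    apply closed_ext with (fun y : sub X B => exists x, F x /\ proj1_sig x = proj1_sig y).
    + intros [x hx]; simpl; split; intros [[y Ay] [Fy E]].
      * simpl in E; subst y.
        exists (exist _ x Ay); split; [exact Fy|]. apply sub_eq; reflexivity.
      * exists (exist _ y Ay); split; [exact Fy|].
        apply (f_equal (@proj1_sig _ _)) in E; exact E.
    + apply (closed_preimage _ _ _ _ (continuous_incl X B) (closed_map_incl X A cA F cF)).
  - intros x y E. apply sub_eq. apply (f_equal (@proj1_sig _ _)) in E; exact E.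
Qed.

Lemma closed_map_inl (A B : Top) : closed_map (fun a : A => inl a : sum_top A B).
Proof.
  intros F cF; split.
  - apply (closed_ext A F); [|exact cF]. intro x; split; [eauto|].
    intros [y [Fy E]]; injection E as ->; exact Fy.
  - apply op_ext with (fun _ => True); [|apply op_full].
    intro b; split; [|auto]. intros _ [a [_ E]]; discriminate.
Qed.

Lemma closed_map_inr (A B : Top) : closed_map (fun b : B => inr b : sum_top A B).
Proof.
  intros F cF; split.
  - apply op_ext with (fun _ => True); [|apply op_full].
    intro b; split; [|auto]. intros _ [a [_ E]]; discriminate.
  - apply (closed_ext B F); [|exact cF]. intro x; split; [eauto|].
    intros [y [Fy E]]; injection E as ->; exact Fy.
Qed.

Definition in_left (A B : Top) (s : sum_top A B) : Prop :=
  match s with inl _ => True | inr _ => False end.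
Definition in_right (A B : Top) (s : sum_top A B) : Prop :=
  match s with inl _ => False | inr _ => True end.

Lemma sum_parts_clopen (A B : Top) :
  op (in_left A B) /\ closed (sum_top A B) (in_left A B) /\
  closed (sum_top A B) (in_right A B).
Proof.
  assert (T : forall X : Top, op (fun _ : X => ~ False))
    by (intro X; apply op_ext with (fun _ => True); [tauto|apply op_full]).
  assert (F : forall X : Top, op (fun _ : X => ~ True))
    by (intro X; apply op_ext with (fun _ => False); [tauto|apply op_empty]).
  repeat split; simpl; auto using op_full, op_empty.
Qed.

(** Identifies [A] with a clopen part of the sum, in the form of a perfect surjection because [P] is
    invariant under those. *)
Lemma perfect_onto_left (A B : Top) :
  perfect_surj (fun a : A => exist _ (inl a) I : sub (sum_top A B) (in_left A B)).
Proof.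
  apply perfect_bijection.
  - apply continuous_into_sub; simpl. intros V [VA _]; exact VA.
  - intros F cF. apply closed_ext with (fun s : sub (sum_top A B) (in_left A B) =>
        exists a, F a /\ inl a = proj1_sig s).
    + intros [s hs]; simpl; split; intros [a [Fa E]]; exists a; split; auto.
      * apply sub_eq; exact E.
      * apply (f_equal (@proj1_sig _ _)) in E; exact E.
    + apply (closed_preimage _ _ _ _ (continuous_incl _ _) (closed_map_inl A B F cF)).
  - intros x y E. apply (f_equal (@proj1_sig _ _)) in E; injection E; auto.
  - intros [[a|b] h]; [|destruct h]. exists a; apply sub_eq; reflexivity.
Qed.

Lemma perfect_onto_right (A B : Top) :
  perfect_surj (fun b : B => exist _ (inr b) I : sub (sum_top A B) (in_right A B)).
Proof.
  apply perfect_bijection.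
  - apply continuous_into_sub; simpl. intros V [_ VB]; exact VB.
  - intros F cF. apply closed_ext with (fun s : sub (sum_top A B) (in_right A B) =>
        exists b, F b /\ inr b = proj1_sig s).
    + intros [s hs]; simpl; split; intros [b [Fb E]]; exists b; split; auto.
      * apply sub_eq; exact E.
      * apply (f_equal (@proj1_sig _ _)) in E; exact E.
    + apply (closed_preimage _ _ _ _ (continuous_incl _ _) (closed_map_inr A B F cF)).
  - intros x y E. apply (f_equal (@proj1_sig _ _)) in E; injection E; auto.
  - intros [[a|b] h]; [destruct h|]. exists b; apply sub_eq; reflexivity.
Qed.

(** * Quotients *)

Section Quotient.
Variables (X : Top) (E : X -> X -> Prop).
Hypothesis E_refl : forall x, E x x.
Hypothesis E_sym : forall x y, E x y -> E y x.
Hypothesis E_trans : forall x y z, E x y -> E y z -> E x z.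

(** Points are the classes themselves, so equivalent points get equal images by extensionality. *)
Definition quot_pt : Type := {c : X -> Prop | exists x, c = E x}.

Definition quot_proj (x : X) : quot_pt := exist _ (E x) (ex_intro _ x eq_refl).

Definition quot : Top.
Proof.
  refine {| pt := quot_pt; op := fun U => op (fun x => U (quot_proj x)) |}.
  - apply op_full.
  - intros U V HU HV; exact (op_inter X _ _ HU HV).
  - intros F HF; apply op_local; intros x [U [FU Ux]].
    exists (fun x => U (quot_proj x)); repeat split; eauto.
Defined.

Definition proj : X -> quot := quot_proj.

Lemma proj_surj (c : quot) : exists x, proj x = c.
Proof.
  destruct c as [c [x ->]]; exists x; reflexivity.
Qed.

Lemma proj_eq (x y : X) : proj x = proj y <-> E x y.
Proof.
  split.
  - intro H. apply (f_equal (@proj1_sig _ _)) in H; simpl in H. rewrite H; apply E_refl.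
  - intro H. unfold proj, quot_proj.
    assert (EE : E x = E y).
    { apply functional_extensionality; intro z; apply propositional_extensionality.
      split; eauto. }
    apply eq_sig_hprop; [intros; apply proof_irrelevance|exact EE].
Qed.

Lemma op_quot (U : quot -> Prop) : op U <-> op (fun x => U (proj x)).
Proof. reflexivity. Qed.

Lemma continuous_proj : continuous proj.
Proof. intros V oV; exact oV. Qed.

(** Evaluates [f] at a chosen representative; the choice does not matter since [f] is constant on
    classes. *)
Lemma quot_lift (f : X -> R) :
  rcont f -> (forall x y, E x y -> f x = f y) ->
  exists g : quot -> R, rcont g /\ forall x, g (proj x) = f x.
Proof.
  intros cf Hf.
  set (rep := fun c => proj1_sig (constructive_indefinite_description _ (proj_surj c))).
  assert (Hrep : forall x, f (rep (proj x)) = f x).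
  { intro x. apply Hf, proj_eq. unfold rep.
    destruct (constructive_indefinite_description _ _) as [y Hy]; exact Hy. }
  exists (fun c => f (rep c)); split; [|exact Hrep].
  apply rcont_continuous. intros V oV.
  apply op_ext with (fun x => V (f x)); [intro x; rewrite <- Hrep; reflexivity|].
  apply (proj1 (rcont_continuous X f) cf V oV).
Qed.

End Quotient.

(** * Collapsing a compact subset to a point *)

Section Collapse.
Variables (X : Top) (A : X -> Prop).
Hypothesis (HX : tychonoff X) (KA : compact_set X A).

Definition same_or_both (x y : X) : Prop := x = y \/ (A x /\ A y).

Lemma collapse_eq (x y : X) :
  proj X same_or_both x = proj X same_or_both y <-> same_or_both x y.
Proof.
  apply proj_eq; unfold same_or_both; intros; intuition (subst; auto).
Qed.

(** The saturation of [F] is [F] or the union of [F] and [A], according to whether [F] meets [A]; a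
    compact [A] is closed. *)
Lemma closed_map_collapse : closed_map (proj X same_or_both).
Proof.
  intros F cF. apply op_quot.
  destruct (classic (exists x, F x /\ A x)) as [[a [Fa Aa]]|N].
  - apply (closed_ext X (fun x => F x \/ A x)).
    + intro x; split.
      * intros [Fx|Ax]; [eauto|]. exists a; split; [exact Fa|]. apply collapse_eq; right; auto.
      * intros [y [Fy E]]. apply collapse_eq in E; destruct E as [<-|[_ Ax]]; auto.
    + apply closed_or; [exact cF|apply closed_compact_set; [apply HX|exact KA]].
  - apply (closed_ext X F); [|exact cF]. intro x; split; [eauto|].
    intros [y [Fy E]]. apply collapse_eq in E; destruct E as [<-|[Ay _]]; auto.
    exfalso; eauto.
Qed.

Lemma tychonoff_collapse : tychonoff (quot X same_or_both).
Proof.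
  assert (cA : closed X A) by (apply closed_compact_set; [apply HX|exact KA]).
  apply tychonoff_of_closed_points.
  - intros F c cF nF. destruct (proj_surj _ _ c) as [t <-].
    assert (cF' : closed X (fun x => F (proj X same_or_both x))) by exact cF.
    assert (HT : exists f : X -> R, rcont f /\ f t = 0 /\
       (forall x y, A x -> A y -> f x = f y) /\
       forall x, F (proj X same_or_both x) -> f x = 1).
    (* The function must be constant on [A] in order to descend: it is 0 there if [t] lies in [A],
       and is otherwise made 1 on [A] as well as on the preimage of [F]. *)
    { destruct (classic (A t)) as [At|nA].
      - destruct (separate_compact_closed X A _ (proj1 HX) KA cF') as [f [cf [f0 f1]]].
        + intros x Ax Fx. apply nF. replace (proj X same_or_both t) with (proj X same_or_both x);
            [exact Fx|]. apply collapse_eq; right; auto.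
        + exists f; repeat split; auto. intros x y Ax Ay; rewrite !f0; auto.
      - destruct (proj1 HX _ t (closed_or X _ _ cF' cA)) as [f [cf [f0 f1]]]; [tauto|].
        exists f; repeat split; auto. intros x y Ax Ay; rewrite !f1; auto. }
    destruct HT as [f [cf [f0 [fA f1]]]].
    destruct (quot_lift X same_or_both) with (f := f) as [g [cg Hg]];
      try (unfold same_or_both; intros; intuition (subst; auto)).
    exists g; repeat split; [exact cg|rewrite Hg; exact f0|].
    intros y Fy. destruct (proj_surj _ _ y) as [x <-]. rewrite Hg; auto.
  - intro c. destruct (proj_surj _ _ c) as [t <-].
    apply closed_ext with (fun y => exists x, x = t /\ proj X same_or_both x = y).
    + intro y; split; [intros [x [-> <-]]; auto|intros ->; eauto].
    + apply closed_map_collapse, closed_point, HX.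
Qed.

Lemma perfect_collapse : perfect_surj (proj X same_or_both).
Proof.
  repeat split.
  - apply continuous_proj.
  - apply closed_map_collapse.
  - apply proj_surj.
  - intro c; destruct (proj_surj _ _ c) as [t <-]. apply compact_sub.
    destruct (classic (A t)) as [At|nA].
    + apply compact_set_ext with A; [|exact KA].
      intro x; rewrite collapse_eq; unfold same_or_both; intuition (subst; auto).
    + apply compact_set_subsingleton. intros x y Hx Hy. apply collapse_eq in Hx, Hy.
      unfold same_or_both in *; intuition congruence.
Qed.

End Collapse.

(** * Consequences of compactness-likeness *)

Section CompactnessLike.
Variable P : Top -> Prop.
Hypothesis HP : compactness_like P.

Lemma P_image (X Y : Top) (f : X -> Y) :
  tychonoff X -> tychonoff Y -> perfect_surj f -> P X -> P Y.
Proof. destruct HP as [_ [_ [H _]]]; apply H. Qed.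

Lemma P_preimage (X Y : Top) (f : X -> Y) :
  tychonoff X -> tychonoff Y -> perfect_surj f -> P Y -> P X.
Proof. destruct HP as [_ [_ [_ [H _]]]]; apply H. Qed.

(** Finite additivity for the family with no members. *)
Lemma P_empty (X : Top) : tychonoff X -> (X -> False) -> P X.
Proof.
  intros HX N. destruct HP as [_ [H _]].
  apply (H X HX 0%nat (fun _ _ => True)); [lia|lia|]. intro x; destruct (N x).
Qed.

Lemma P_sum (A B : Top) : tychonoff A -> tychonoff B -> P A -> P B -> P (sum_top A B).
Proof.
  intros HA HB PA PB. destruct (sum_parts_clopen A B) as [_ [cl cr]].
  assert (HS := tychonoff_sum A B HA HB). destruct HP as [_ [H _]].
  apply (H _ HS 2%nat (fun i => match i with O => in_left A B | _ => in_right A B end)).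
  - intros [|i] _; split; auto.
    + apply (P_image _ _ _ HA (tychonoff_sub _ _ HS) (perfect_onto_left A B) PA).
    + apply (P_image _ _ _ HB (tychonoff_sub _ _ HS) (perfect_onto_right A B) PB).
  - intros [|[|i]] [|[|k]] Hi Hk Hik; try lia; intros [a|b]; simpl; auto.
  - intros [a|b]; [exists 0%nat|exists 1%nat]; simpl; auto.
Qed.

(* [B] is a perfect image of [A + B], in which [A] is clopen. *)
Lemma P_closed_embedding (A B : Top) (f : A -> B) :
  tychonoff A -> tychonoff B -> continuous f -> closed_map f ->
  (forall x y, f x = f y -> x = y) -> P B -> P A.
Proof.
  intros HA HB cf clf inj PB. assert (HS := tychonoff_sum A B HA HB).
  assert (PS : P (sum_top A B)).
  { refine (P_preimage _ _ _ HS HB (perfect_sum A B B f (fun b => b) cf clf inj _ _ _ _) PB).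
    - intros V oV; exact oV.
    - intros F cF; apply closed_ext with F; [|exact cF].
      intro x; split; [eauto|intros [y [Fy <-]]; auto].
    - auto.
    - intro y; right; eauto. }
  destruct (sum_parts_clopen A B) as [ol [cl _]].
  apply (P_preimage _ _ _ HA (tychonoff_sub _ _ HS) (perfect_onto_left A B)).
  destruct HP as [H _]. apply (H _ HS PS _ ol cl).
Qed.

(** Additivity concerns disjoint closed sets; overlapping ones are made disjoint in a sum, which
    maps perfectly onto their union. *)
Lemma P_union (X : Top) (A B : X -> Prop) :
  tychonoff X -> closed X A -> closed X B -> P (sub X A) -> P (sub X B) ->
  P (sub X (fun x => A x \/ B x)).
Proof.
  intros HX cA cB PA PB.
  destruct (sub_mono_closed_embedding X A _ (fun x => @or_introl (A x) (B x)) cA) as [c1 [c2 c3]].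
  destruct (sub_mono_closed_embedding X B _ (fun x => @or_intror (A x) (B x)) cB) as [d1 [d2 d3]].
  refine (P_image _ _ _ _ _ (perfect_sum _ _ _ _ _ c1 c2 c3 d1 d2 d3 _) (P_sum _ _ _ _ PA PB));
    auto using tychonoff_sum, tychonoff_sub.
  intros [x [Ax|Bx]]; [left; exists (exist _ x Ax)|right; exists (exist _ x Bx)];
    apply sub_eq; reflexivity.
Qed.

(* Mrowka's condition (W) with the point replaced by a compact set: collapse the set. *)
Lemma P_outside_compact (X : Top) (A : X -> Prop) :
  tychonoff X -> compact_set X A ->
  (forall V, op V -> (forall x, A x -> V x) -> P (sub X (fun x => ~ V x))) -> P X.
Proof.
  intros HX KA HV. destruct (classic (exists a, A a)) as [[a Aa]|N].
  - assert (PF := perfect_collapse X A HX KA).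
    assert (HQ := tychonoff_collapse X A HX KA).
    apply (P_preimage _ _ _ HX HQ PF).
    destruct HP as [_ [_ [_ [_ W]]]].
    apply (W _ (proj X (same_or_both X A) a) (fun B => op B /\ B (proj X (same_or_both X A) a)) HQ).
    + split; [auto|]. intros U oU Ua; exists U; auto.
    (* The complement of [B] is the perfect image of its full preimage, which is the complement of
       an open set containing [A]. *)
    + intros B [oB Ba].
      apply (P_image _ _ _ (tychonoff_sub _ _ HX) (tychonoff_sub _ _ HQ)
        (perfect_restrict _ _ _ (fun c => ~ B c) PF)).
      apply (HV (fun x => B (proj X (same_or_both X A) x))); [exact oB|].
      intros x Ax. replace (proj X (same_or_both X A) x) with (proj X (same_or_both X A) a);
        [exact Ba|]. apply collapse_eq; right; auto.
  (* When [A] is empty there is no point at which to apply (W), but the empty set is an admissible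
     [V] and its complement is a copy of [X]. *)
  - assert (cT : closed X (fun _ => ~ False)) by (apply closed_compl, op_empty).
    apply (P_image (sub X (fun _ => ~ False)) X (fun y => proj1_sig y)); auto using tychonoff_sub.
    + apply perfect_bijection; auto using continuous_incl, closed_map_incl.
      * intros x y; apply sub_eq.
      * intro y; exists (exist _ y (fun H => H)); reflexivity.
    + apply HV; [apply op_empty|]. intros x Ax; apply N; eauto.
Qed.

End CompactnessLike.

(** * Extensions inside a compactification *)

Lemma embedding_closure (X K : Top) (e : X -> K) (C : X -> Prop) (x : X) :
  embedding e -> closure K (fun q => exists c, C c /\ e c = q) (e x) -> closure X C x.
Proof.
  intros [_ [_ oe]] H. apply closure_meets. intros U oU Ux.
  destruct (oe U oU) as [V [oV EV]].
  destruct (proj1 (closure_meets _ _ _) H V oV) as [q [[c [Cc <-]] Vc]]; [apply EV, Ux|].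
  exists c; split; [exact Cc|apply EV, Vc].
Qed.

(** Each point of [Q] has an open neighbourhood whose trace on [X] lies in the closure of some [C];
    finitely many of these closures suffice, and [P_union] joins them. *)
Lemma lambdaP_compact (P : Top -> Prop) (X K : Top) (e : X -> K) (Q : K -> Prop) :
  compactness_like P -> tychonoff X -> embedding e -> compact_set K Q ->
  (forall p, Q p -> lambdaP P X K e p) ->
  exists D, closed X D /\ P (sub X D) /\ forall x, Q (e x) -> D x.
Proof.
  intros HP HX He KQ HQ.
  destruct (compact_set_ind K Q (fun W => exists D, closed X D /\ P (sub X D) /\
      forall x, W (e x) -> D x) KQ) as [W [_ [QW [D [cD [PD HD]]]]]].
  - exists (fun _ => False); repeat split; auto using closed_empty.
    apply P_empty; auto using tychonoff_sub. intros [x []].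
  - intros U V [D [cD [PD HD]]] [D' [cD' [PD' HD']]].
    exists (fun x => D x \/ D' x); repeat split; [apply closed_or|apply P_union|]; auto.
    intros x [Ux|Vx]; auto.
  - intros p Qp. destruct (HQ p Qp) as [C [_ [PC [U [oU [Up HU]]]]]].
    exists U; repeat split; auto. exists (closure X C); repeat split; auto using closed_closure.
    intros x Ux. apply (embedding_closure X K e); auto.
  - exists D; auto.
Qed.

Lemma dense_XuE (X Z : Top) (z : X -> Z) (E : Z -> Prop) :
  dense Z (image z) -> dense (sub Z (XuE X Z z E)) (image (XuE_inc X Z z E)).
Proof.
  intros dz [y hy]. apply closure_meets. intros U [V [oV EV]] Uy. apply EV in Uy.
  destruct (proj1 (closure_meets _ _ _) (dz y) V oV Uy) as [q [[x <-] Vx]].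
  exists (XuE_inc X Z z E x); split; [exists x; reflexivity|apply EV, Vx].
Qed.

Lemma embedding_XuE_inc (X Z : Top) (z : X -> Z) (E : Z -> Prop) :
  embedding z -> embedding (XuE_inc X Z z E).
Proof.
  intros [inj [cz oz]]; repeat split.
  - intros x y H. apply inj. apply (f_equal (@proj1_sig _ _)) in H; exact H.
  - apply continuous_into_sub, cz.
  - intros U oU. destruct (oz U oU) as [V [oV EV]].
    exists (fun y => V (proj1_sig y)); split; [apply sub_op_trace, oV|exact EV].
Qed.

Lemma XuE_inEP (P : Top -> Prop) (X K : Top) (e : X -> K) (Z : Top) (z : X -> Z)
    (phi : K -> Z) (E : Z -> Prop) :
  compactness_like P -> tychonoff X -> stone_cech X K e -> compactification X Z z ->
  continuous phi -> (forall x, phi (e x) = z x) ->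
  (forall q, E q -> ~ image z q) -> compact (sub Z E) ->
  (forall p, ~ lambdaP P X K e p -> E (phi p)) ->
  inEP P X (sub Z (XuE X Z z E)) (XuE_inc X Z z E).
Proof.
  intros HP HX [KK [_ [He _]]] [KZ [HZ [Hz dz]]] cphi phie EX KE HE.
  assert (TZ := tychonoff_compact_hausdorff Z KZ HZ).
  set (Y := sub Z (XuE X Z z E)).
  assert (TY : tychonoff Y) by (apply tychonoff_sub, TZ).
  apply compact_sub in KE.
  assert (KEY : compact_set Y (fun y => E (proj1_sig y))).
  { apply compact_set_in_sub. revert KE; apply compact_set_ext.
    intro q; split; [|intros [h H]; exact H].
    intro Eq; exists (or_intror Eq); exact Eq. }
  split; [exact TY|]. split; [apply embedding_XuE_inc, Hz|].
  split; [apply dense_XuE, dz|]. split.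
  - apply (P_outside_compact P HP Y _ TY KEY). intros V [W [oW EW]] EV.
    (* Points outside [lambdaP] are sent into [E], hence into [W]; so the compact preimage of the
       complement of [W] lies in [lambdaP]. *)
    destruct (lambdaP_compact P X K e (fun p => ~ W (phi p)) HP HX He) as [D [cD [PD HD]]].
    { apply compact_set_closed; [exact KK|]. apply closed_compl, cphi, oW. }
    { intros p nW; apply NNPP; intro nL; apply nW. assert (Ep := HE p nL).
      apply (EW (exist _ (phi p) (or_intror Ep))), EV, Ep. }
    (* As [E] lies in [V], the complement of [V] in [Y] is a copy of this closed subset of [X],
       which inherits [P] from [D]. *)
    set (B := fun x => ~ W (z x)).
    assert (cB : closed X B) by (apply closed_compl, (proj1 (proj2 Hz)), oW).
    assert (BD : forall x, B x -> D x) by (intros x Bx; apply HD; rewrite phie; exact Bx).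
    destruct (sub_mono_closed_embedding X B D BD cB) as [c1 [c2 c3]].
    assert (PB : P (sub X B))
      by (apply (P_closed_embedding P HP _ _ _ (tychonoff_sub _ _ HX) (tychonoff_sub _ _ HX)
            c1 c2 c3 PD)).
    assert (hB : forall x : sub X B, ~ V (XuE_inc X Z z E (proj1_sig x)))
      by (intros [x Bx] H; apply EW in H; exact (Bx H)).
    apply (P_image P HP (sub X B) (sub Y (fun y => ~ V y))
      (fun x : sub X B => exist _ (XuE_inc X Z z E (proj1_sig x)) (hB x)));
      auto using tychonoff_sub.
    destruct Hz as [inj [cz oz]].
    apply perfect_bijection.
    + apply continuous_into_sub, continuous_into_sub; simpl. intros U oU.
      apply (sub_op_trace X B (fun x => U (z x))), cz, oU.
    (* The open set [U] of [Z] traces the complement of [F] on [X]. No point of [E] remains outside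
       [V], so the complement of [U] cuts out exactly the image of [F]. *)
    + intros F cF. apply (closed_map_incl X B cB) in cF.
      destruct (oz _ cF) as [U [oU EU]].
      apply closed_ext with (fun y : sub Y (fun y => ~ V y) => ~ U (proj1_sig (proj1_sig y)));
        [|apply closed_compl, (sub_op_trace Y _ (fun y => U (proj1_sig y))), sub_op_trace, oU].
      intros [[q hq] nV]; simpl; split.
      * intro nU. destruct hq as [[x <-]|Eq].
        -- assert (nnF := fun H => nU (proj1 (EU x) H)). apply NNPP in nnF.
           destruct nnF as [x' [Fx' E']]; exists x'; split; [exact Fx'|].
           apply sub_eq, sub_eq; simpl; rewrite E'; reflexivity.
        -- destruct nV. apply EV, Eq.
      * intros [x [Fx Eq]] Uq. apply (f_equal (@proj1_sig _ _)) in Eq; simpl in Eq.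
        apply (f_equal (@proj1_sig _ _)) in Eq; simpl in Eq; subst q.
        apply EU in Uq; apply Uq; exists x; auto.
    + intros x y H. apply (f_equal (@proj1_sig _ _)) in H; simpl in H.
      apply (f_equal (@proj1_sig _ _)) in H; simpl in H. apply sub_eq, inj, H.
    + intros [[q [[x Hx]|Eq]] nV].
      * subst q. assert (Bx : B x) by (intro Wx; apply nV, EW, Wx).
        exists (exist _ x Bx); apply sub_eq, sub_eq; reflexivity.
      * destruct nV; apply EV, Eq.
  - apply compact_sub. revert KEY; apply compact_set_ext. intros [q hq]; simpl; split.
    + intros Eq [x Hx]. apply (EX q Eq). exists x.
      apply (f_equal (@proj1_sig _ _)) in Hx; exact Hx.
    + intro N; destruct hq as [[x <-]|Eq]; [|exact Eq].
      destruct N; exists x; reflexivity.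
Qed.

(** * The Stone-Cech compactification of an extension, as a quotient of that of [X] *)

Section Extension.
Variables (X K T : Top) (e : X -> K) (j : X -> T).
Hypothesis HK : stone_cech X K e.
Hypothesis TT : tychonoff T.
Hypothesis Hj : embedding j.
Hypothesis dj : dense T (image j).

(** Such pairs are the test functions that relate points of [K] to points of [T]. *)
Definition extends (H : K -> R) (g : T -> R) : Prop :=
  rcont H /\ rcont g /\ forall x, H (e x) = g (j x).

(** The fibre relation of the natural map from [K] to the Stone-Cech compactification of [T],
    expressed by functions so that the target can be built from it. *)
Definition glued (p q : K) : Prop := forall H g, extends H g -> H p = H q.

(** Membership of [p] in the fibre of that map above [t]. *)
Definition over (t : T) (p : K) : Prop := forall H g, extends H g -> H p = g t.

Definition betaT : Top := quot K glued.
Definition pr : K -> betaT := proj K glued.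

Lemma pr_eq (p q : K) : pr p = pr q <-> glued p q.
Proof.
  apply proj_eq; unfold glued; intros.
  - reflexivity.
  - symmetry; eauto.
  - transitivity (H1 y); eauto.
Qed.

Lemma over_glued (t : T) (p q : K) : over t p -> over t q -> glued p q.
Proof. intros Hp Hq H g HH. rewrite (Hp H g HH), (Hq H g HH); reflexivity. Qed.

Lemma betaT_lift (H : K -> R) (g : T -> R) :
  extends H g -> exists G : betaT -> R, rcont G /\ forall p, G (pr p) = H p.
Proof.
  intro HH. apply quot_lift; unfold glued.
  - reflexivity.
  - intros p q E F f HF; symmetry; eauto.
  - intros p q r E1 E2 F f HF; transitivity (F q); eauto.
  - apply HH.
  - intros p q E; eapply E; eauto.
Qed.

Lemma extends_exists (g : T -> R) :
  rcont g -> (forall t, 0 <= g t <= 1) -> exists H, extends H g.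
Proof.
  intros cg Hg.
  destruct (stone_cech_extend X K e (fun x => g (j x)) HK) as [H [cH EH]].
  - apply rcont_comp; [apply Hj|exact cg].
  - auto.
  - exists H; repeat split; auto.
Qed.

Lemma compact_betaT : compact betaT.
Proof.
  destruct HK as [KK _]. apply compact_set_full in KK. apply compact_set_full.
  apply (compact_set_image _ _ pr _ (continuous_proj K glued)) in KK.
  revert KK; apply compact_set_ext. intro c; split; auto.
  intros _; destruct (proj_surj _ _ c) as [p <-]; exists p; auto.
Qed.

Lemma hausdorff_betaT : hausdorff betaT.
Proof.
  intros c d Hcd.
  destruct (proj_surj _ _ c) as [p Hp], (proj_surj _ _ d) as [q Hq]; subst c d.
  assert (N : exists H g, extends H g /\ H p <> H q).
  { apply NNPP; intro N; apply Hcd, pr_eq. intros H g HH.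
    apply NNPP; intro Hne; apply N; eauto. }
  destruct N as [H [g [HH Hne]]]. destruct (betaT_lift H g HH) as [G [cG EG]].
  assert (Hd : 0 < Rabs (H p - H q)) by (apply Rabs_pos_lt; lra).
  set (d := Rabs (H p - H q) / 2).
  exists (fun c => Rabs (G c - H p) < d), (fun c => Rabs (G c - H q) < d); repeat split.
  - apply rcont_ball, cG.
  - apply rcont_ball, cG.
  - fold pr; rewrite EG, Rminus_diag, Rabs_R0; unfold d; lra.
  - fold pr; rewrite EG, Rminus_diag, Rabs_R0; unfold d; lra.
  - intros z H1 H2. rewrite Rabs_minus_sym in H1.
    pose proof (Rabs_triang (H p - G z) (G z - H q)) as H3.
    replace (H p - G z + (G z - H q)) with (H p - H q) in H3 by ring. unfold d in *; lra.
Qed.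

(** A tube lemma. A point [p] off the fibre of [t] admits a pair with [H p <> g t], so [b y] near
    [p] keeps [a y] away from [t]; compactness of [K] yields a single [N]. The index type [Y] is
    free because both [X] and [T] are used. *)
Lemma fibre_tube (Y : Type) (a : Y -> T) (b : Y -> K) (t : T) (V : K -> Prop) :
  (forall y, over (a y) (b y)) -> op V -> (forall p, over t p -> V p) ->
  exists N, op N /\ N t /\ forall y, N (a y) -> V (b y).
Proof.
  intros Hab oV HV. destruct HK as [KK _]. apply compact_set_full in KK.
  destruct (compact_set_ind K _ (fun U => exists N, op N /\ N t /\
      forall y, N (a y) -> U (b y) -> V (b y)) KK) as [W [_ [HW [N [oN [Nt HN]]]]]].
  - exists (fun _ => True); repeat split; auto using op_full. intros y _ [].
  - intros U U' [N [oN [Nt HN]]] [N' [oN' [Nt' HN']]].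
    exists (fun s => N s /\ N' s); repeat split; auto using op_inter.
    intros y [Ny Ny'] [Uy|Uy]; auto.
  - intros p _. destruct (classic (over t p)) as [Hp|Hp].
    + exists V; repeat split; auto. exists (fun _ => True); auto using op_full.
    + assert (Hne : exists H g, extends H g /\ H p <> g t).
      { apply NNPP; intro Nx; apply Hp. intros H g HH.
        apply NNPP; intro Hne; apply Nx; eauto. }
      destruct Hne as [H [g [HH Hne]]]. assert (HH' := HH). destruct HH' as [cH [cg _]].
      assert (Hd : 0 < Rabs (H p - g t)) by (apply Rabs_pos_lt; lra).
      exists (fun q => Rabs (H q - H p) < Rabs (H p - g t) / 2); repeat split.
      * apply rcont_ball, cH.
      * rewrite Rminus_diag, Rabs_R0; lra.
      * exists (fun s => Rabs (g s - g t) < Rabs (H p - g t) / 2); repeat split.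
        -- apply rcont_ball, cg.
        -- rewrite Rminus_diag, Rabs_R0; lra.
        -- intros y H1 H2. rewrite (Hab y H g HH), Rabs_minus_sym in H2.
           pose proof (Rabs_triang (H p - g (a y)) (g (a y) - g t)) as H3.
           replace (H p - g (a y) + (g (a y) - g t)) with (H p - g t) in H3 by ring. lra.
  - exists N; auto.
Qed.

Lemma over_inc (x : X) : over (j x) (e x).
Proof. intros H g [_ [_ E]]; apply E. Qed.

(** If the fibre were empty, [fibre_tube] with the empty set as [V] would give a neighbourhood of
    [t] missing the dense image of [X]. *)
Lemma over_exists (t : T) : exists p, over t p.
Proof.
  apply NNPP; intro N.
  destruct (fibre_tube X j e t (fun _ => False) over_inc (op_empty K)) as [U [oU [Ut HU]]].
  - intros p Hp; apply N; eauto.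
  - destruct (proj1 (closure_meets _ _ _) (dj t) U oU Ut) as [s [[x <-] Us]]. eapply HU, Us.
Qed.

(** An arbitrary choice; by [over_glued] its class in [betaT] depends only on [t]. *)
Definition point_over (t : T) : K :=
  proj1_sig (constructive_indefinite_description _ (over_exists t)).

Lemma point_overP (t : T) : over t (point_over t).
Proof. apply (proj2_sig (constructive_indefinite_description _ (over_exists t))). Qed.

Definition inc (t : T) : betaT := pr (point_over t).

Lemma inc_j (x : X) : inc (j x) = pr (e x).
Proof. apply pr_eq, (over_glued (j x)); [apply point_overP|apply over_inc]. Qed.

(** The preimage of [V] in [K] is open and contains the whole fibre of [t], so [fibre_tube] applies
    to the chosen points. *)
Lemma continuous_inc : continuous inc.
Proof.
  intros V oV. apply op_local; intros t Vt.
  destruct (fibre_tube T (fun s => s) point_over t (fun p => V (pr p)) point_overP oV)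
    as [N [oN [Nt HN]]].
  - intros p Hp. replace (pr p) with (inc t); [exact Vt|].
    apply pr_eq, (over_glued t); [apply point_overP|exact Hp].
  - exists N; auto.
Qed.

(** Complete regularity gives a function on [T]; once truncated it extends to [K], then descends to
    [betaT] with the same values on [T]. *)
Lemma inc_separates (t : T) (U : T -> Prop) :
  op U -> U t -> exists V : betaT -> Prop, op V /\ V (inc t) /\ forall s, V (inc s) -> U s.
Proof.
  intros oU Ut. destruct (proj1 TT (fun s => ~ U s) t) as [f [cf [f0 f1]]];
    [apply closed_compl, oU|tauto|].
  assert (cg : rcont (fun s => clamp (1 * f s + 0))) by (apply rcont_clamp, cf).
  destruct (extends_exists _ cg) as [H HH]; [intro; apply clamp_range|].
  destruct (betaT_lift _ _ HH) as [G [cG EG]].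
  assert (EG' : forall s, G (inc s) = clamp (1 * f s + 0)).
  { intro s; unfold inc; rewrite EG; apply (point_overP s _ _ HH). }
  exists (fun c => G c < 1); repeat split.
  - apply rcont_lt, cG.
  - rewrite EG', f0, clamp_nonpos; lra.
  - intros s Hs. apply NNPP; intro nU. rewrite EG', f1, clamp_ge1 in Hs; auto; lra.
Qed.

Lemma embedding_inc : embedding inc.
Proof.
  repeat split.
  - intros s t E. apply NNPP; intro Hst.
    destruct (proj2 TT s t Hst) as [U [V [oU [oV [Us [Vt D]]]]]].
    destruct (inc_separates s U oU Us) as [W [_ [Ws HW]]].
    apply (D t); [|exact Vt]. apply HW; rewrite <- E; exact Ws.
  - exact continuous_inc.
  - intros U oU.
    exists (fun c => exists V, (op V /\ forall s, V (inc s) -> U s) /\ V c); split.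
    + apply op_union; intros V [oV _]; exact oV.
    + intro t; split.
      * intro Ut. destruct (inc_separates t U oU Ut) as [V [oV [Vt HV]]]; eauto.
      * intros [V [[_ HV] Vt]]; auto.
Qed.

Lemma compactification_betaT : compactification X betaT (fun x => pr (e x)).
Proof.
  repeat apply conj; [exact compact_betaT|exact hausdorff_betaT| | | |].
  - intros x y E. apply Hj, embedding_inc. rewrite !inc_j; exact E.
  - intros V oV. destruct HK as [_ [_ [[_ [ce _]] _]]].
    apply (ce (fun p => V (pr p))), oV.
  (* Open sets are extended in two stages, from [X] to [T] and from [T] to [betaT]. *)
  - intros U oU. destruct Hj as [_ [_ oj]]. destruct (oj U oU) as [V [oV EV]].
    destruct embedding_inc as [_ [_ oi]]. destruct (oi V oV) as [W [oW EW]].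
    exists W; split; [exact oW|]. intro x; rewrite EV, EW, inc_j; reflexivity.
  - intro c; destruct (proj_surj _ _ c) as [p <-]. apply closure_meets. intros U oU Up.
    destruct HK as [_ [_ [_ [de _]]]].
    destruct (proj1 (closure_meets _ _ _) (de p) (fun q => U (pr q)) oU Up) as [q [[x <-] Ux]].
    exists (pr (e x)); split; [exists x; reflexivity|exact Ux].
Qed.

(** * The remainder of [T] inside [betaT] *)

Definition remainder (c : betaT) : Prop := exists t, ~ image j t /\ inc t = c.

Lemma remainder_disjoint (c : betaT) : remainder c -> ~ image (fun x => pr (e x)) c.
Proof.
  intros [t [nt <-]] [x Hx]. apply nt. exists x. apply embedding_inc.
  rewrite inc_j; exact Hx.
Qed.

Lemma compact_remainder :
  compact (sub T (fun t => ~ image j t)) -> compact_set betaT remainder.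
Proof.
  intro H; apply compact_sub in H. apply (compact_set_image _ _ inc _ continuous_inc H).
Qed.

(** The image of [inc] is exactly the union of [X] and the remainder; the inverse chooses preimages
    and is continuous because [inc] is an embedding. *)
Lemma extension_homeomorphism :
  exists h : T -> sub betaT (XuE X betaT (fun x => pr (e x)) remainder),
    homeomorphism h /\ forall x, h (j x) = XuE_inc X betaT (fun x => pr (e x)) remainder x.
Proof.
  set (S := XuE X betaT (fun x => pr (e x)) remainder).
  assert (HS : forall t, S (inc t)).
  { intro t. destruct (classic (image j t)) as [[x <-]|N].
    - left; exists x; symmetry; apply inc_j.
    - right; exists t; auto. }
  assert (Hsur : forall y : sub betaT S, exists t, inc t = proj1_sig y).
  { intros [c [[x <-]|[t [nt E]]]]; [exists (j x); apply inc_j|exists t; exact E]. }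
  set (h := fun t => exist _ (inc t) (HS t) : sub betaT S).
  set (g := fun y => proj1_sig (constructive_indefinite_description _ (Hsur y))).
  assert (Hg : forall y, inc (g y) = proj1_sig y).
  { intro y. apply (proj2_sig (constructive_indefinite_description _ (Hsur y))). }
  exists h; split.
  - exists g; repeat split.
    + apply continuous_into_sub, continuous_inc.
    + intros V oV. destruct embedding_inc as [_ [_ oi]]. destruct (oi V oV) as [W [oW EW]].
      exists W; split; [exact oW|]. intro y; rewrite EW, Hg; reflexivity.
    + intro t. apply embedding_inc, Hg.
    + intro y. apply sub_eq, Hg.
  - intro x. apply sub_eq, inc_j.
Qed.

(** A closed subset of [X] may accumulate at the remainder of [T]. Confinement to a closed [L] of
    [T] inside the image of [X] prevents this: within [L], closedness is decided by traces on
    [X]. *)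
Lemma closed_map_off_remainder (D : X -> Prop) (L : T -> Prop) :
  closed X D -> closed T L -> (forall t, L t -> image j t) -> (forall x, D x -> L (j x)) ->
  closed_map (fun x : sub X D => j (proj1_sig x)).
Proof.
  intros cD cL LX DL F cF. apply (closed_map_incl X D cD) in cF.
  destruct (proj2 (proj2 Hj) _ cF) as [V [oV EV]].
  apply op_ext with (fun t => ~ L t \/ V t); [|apply op_or; assumption].
  intro t; split.
  - intros H [x [Fx <-]]. destruct H as [nL|Vx].
    + apply nL, DL, (proj2_sig x).
    + apply EV in Vx; eauto.
  - intro H. destruct (classic (L t)) as [Lt|]; [right|auto].
    destruct (LX t Lt) as [x <-]. apply EV. intros [y [Fy E]]; apply H.
    exists y; split; [exact Fy|rewrite E; reflexivity].
Qed.

Lemma remainder_covers (P : Top -> Prop) (phi : K -> betaT) (p : K) :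
  compactness_like P -> tychonoff X -> P T -> compact (sub T (fun t => ~ image j t)) ->
  continuous phi -> (forall x, phi (e x) = pr (e x)) ->
  ~ lambdaP P X K e p -> remainder (phi p).
Proof.
  intros HP HX PT KT cphi phie nL. apply NNPP; intro nR; apply nL; clear nL.
  assert (TB := tychonoff_compact_hausdorff _ compact_betaT hausdorff_betaT).
  destruct (proj1 TB remainder (phi p)) as [f [cf [f0 f1]]];
    [apply closed_compact_set; [apply TB|apply compact_remainder, KT]|exact nR|].
  assert (HK' := HK); destruct HK' as [_ [_ [[_ [ce _]] [de _]]]].
  assert (cpe : continuous (fun x => pr (e x))) by (intros V oV; apply (ce _ oV)).
  set (C := fun x => f (pr (e x)) < 1/2).
  exists C; repeat split.
  (* The positive part of [1/2 - f] is nonzero exactly on [C]. *)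
  - exists (fun x => clamp (-1 * f (pr (e x)) + 1/2)); split.
    + apply (rcont_clamp X (fun x => f (pr (e x)))), (rcont_comp _ _ _ _ cpe cf).
    + intro x; unfold C; split; intro H.
      * unfold clamp; solve_minmax.
      * apply Rnot_le_lt; intro H'; apply H, clamp_nonpos; lra.
  (* As [f] is 1 on the remainder, [L] stays inside the image of [X]; being closed, it contains the
     image of the closure of [C]. *)
  - set (L := fun t => ~ (1/2 < f (inc t))).
    assert (cL : closed T L).
    (* [rcont_lt] treats sublevel sets, so [1/2 < f] is rewritten as [clamp (3/2 - f) < 1]. *)
    { apply closed_compl. apply op_ext with (fun t => clamp (-1 * f (inc t) + 3/2) < 1).
      - intro t; unfold clamp; split; intro H; solve_minmax.
      - apply rcont_lt, (rcont_clamp T (fun t => f (inc t))),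
          (rcont_comp _ _ _ _ continuous_inc cf). }
    assert (CL : forall x, closure X C x -> L (j x)).
    { intros x Hx. apply (Hx (fun x => L (j x))).
      - apply (closed_preimage X T j L); [apply Hj|exact cL].
      - intros y Cy; unfold L, C in *; rewrite inc_j; lra. }
    apply (P_closed_embedding P HP _ T (fun x : sub X (closure X C) => j (proj1_sig x))); auto.
    + apply tychonoff_sub, HX.
    + intros V oV. apply (sub_op_trace X _ (fun x => V (j x))), Hj, oV.
    + apply closed_map_off_remainder with L; auto using closed_closure.
      intros t Lt; apply NNPP; intro nt; apply Lt. rewrite f1; [lra|]. exists t; auto.
    + intros x y E; apply sub_eq, Hj, E.
  (* By density of [X] in [K], this open set lies in the closure of its trace on [X], and the trace
     is [C] because [phi] and [pr] agree there. *)
  - exists (fun q => f (phi q) < 1/2); repeat split.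
    + apply (rcont_lt K (fun q => f (phi q))), (rcont_comp _ _ _ _ cphi cf).
    + rewrite f0; lra.
    + intros q Hq. apply closure_meets. intros U oU Uq.
      destruct (proj1 (closure_meets _ _ _) (de q) (fun q => U q /\ f (phi q) < 1/2))
        as [y [[x <-] [Ux Hx]]].
      * apply op_inter; [exact oU|].
        apply (rcont_lt K (fun q => f (phi q))), (rcont_comp _ _ _ _ cphi cf).
      * auto.
      * exists (e x); split; [|exact Ux]. exists x; split; [|reflexivity].
        unfold C; rewrite <- phie; exact Hx.
Qed.

End Extension.

Theorem theorem4p9 (P : Top -> Prop) (X K : Top) (e : X -> K) :
  compactness_like P -> tychonoff X -> locally_P P X -> stone_cech X K e ->
  (forall (Z : Top) (z : X -> Z) (phi : K -> Z) (E : Z -> Prop),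
     compactification X Z z ->
     continuous phi -> (forall x, phi (e x) = z x) ->
     (forall q, E q -> ~ image z q) -> compact (sub Z E) ->
     (forall p, ~ lambdaP P X K e p -> E (phi p)) ->
     inEP P X (sub Z (XuE X Z z E)) (XuE_inc X Z z E))
  /\
  (forall (T : Top) (j : X -> T), inEP P X T j ->
     exists (Z : Top) (z : X -> Z) (E : Z -> Prop),
       compactification X Z z /\
       (forall q, E q -> ~ image z q) /\ compact (sub Z E) /\
       (forall phi : K -> Z, continuous phi -> (forall x, phi (e x) = z x) ->
          forall p, ~ lambdaP P X K e p -> E (phi p)) /\
       exists h : T -> sub Z (XuE X Z z E),
         homeomorphism h /\ forall x, h (j x) = XuE_inc X Z z E x).
Proof.
  intros HP HX _ HK; split.
  - intros; eapply XuE_inEP; eauto.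
  - intros T j [TT [Hj [dj [PT KT]]]].
    exists (betaT X K T e j), (fun x => pr X K T e j (e x)), (remainder X K T e j HK dj).
    split; [|split; [|split; [|split]]].
    + apply compactification_betaT; assumption.
    + intros q Hq; eapply remainder_disjoint; eauto.
    + apply compact_sub, compact_remainder; assumption.
    (* Here [phi] is an arbitrary continuous extension, not just the quotient map [pr]; its
       continuity and its values on [X] suffice. *)
    + intros; eapply remainder_covers; eauto.
    + apply extension_homeomorphism; assumption.
Qed.
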